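(* Let $i_0\in\{1,\dots,n\}$, let $x^0\in\mathbb{C}^n$ with $x^0_{i_0}=0$, and let $\phi$ be holomorphic on a polydisc $U$ centered at $x^0$ and satisfy $$\phi(x_1,\dots,\zeta x_{i_0},\dots,x_n)=\phi(x_1,\dots,x_{i_0},\dots,x_n)\qquad\text{for every }\zeta\in\mu_r\text{ and every }x\in U.$$ Then $\partial_{i_0}^m\phi(x^0)=0$ for $1\le m\le r-1$, and $\Delta_{i_0}\phi$ extends holomorphically across $x_{i_0}=0$, with $$\Delta_{i_0}\phi(x^0)=\frac{1}{r!}\,\partial_{i_0}^{\,r}\phi(x^0).$$
   Context: Let $n,r\ge1$ be integers and $\mu_r$ the group of $r$-th roots of unity in $\mathbb{C}$. Write $\partial_{i_0}=\partial_{x_{i_0}}$; where $x_{i_0}\ne0$, $\Delta_{i_0}=\frac{1}{r\,x_{i_0}^{r-1}}\partial_{x_{i_0}}$. In the last formula $\Delta_{i_0}\phi(x^0)$ denotes the value at $x^0$ of the holomorphic extension to $U$. *)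

(* Defs.v *)
From HB Require Import structures.
From mathcomp Require Import all_boot all_order all_algebra.
From mathcomp Require Import complex.
From mathcomp Require Import all_classical all_reals all_analysis.

Set Implicit Arguments.
Unset Strict Implicit.
Unset Printing Implicit Defensive.

Import Order.TTheory GRing.Theory Num.Theory.
Import numFieldNormedType.Exports.

Local Open Scope complex_scope.
Local Open Scope classical_set_scope.
Local Open Scope ring_scope.

(* The field R[i] seen as a numFieldType, so that MathComp-Analysis finds its
   topology and norm; 'rV[Cplx R]_n carries the sup norm. *)
Definition Cplx (R : realType) : numFieldType := R[i].

Section SeveralComplexVariables.
Context {R : realType} {n : nat}.
Local Notation C := (Cplx R).
Implicit Types (U : set 'rV[C]_n) (f g : 'rV[C]_n -> C) (x : 'rV[C]_n).

Definition polydisc (c : 'rV[C]_n) (rho : 'I_n -> R) : set 'rV[C]_n :=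
  [set x : 'rV[C]_n | forall j, `|x 0 j - c 0 j| < (rho j)%:C].

(* Only meaningful for open U: [differentiable] is Frechet differentiability
   over the scalar field C, with a C-linear differential. *)
Definition holomorphic_on U f := forall x, U x -> differentiable f x.

Definition partial (i : 'I_n) f : 'rV[C]_n -> C := 'D_('e_i) f.

Definition scale_coord (i : 'I_n) (zeta : C) x : 'rV[C]_n :=
  \row_j (if j == i then zeta * x 0 j else x 0 j).

(* (r * 0)^-1 = 0, so this is only meaningful where x 0 i != 0 or r = 1. *)
Definition Delta (r : nat) (i : 'I_n) f x : C :=
  (r%:R * x 0 i ^+ r.-1)^-1 * partial i f x.

(* g is a holomorphic extension to U of f, f being considered off the
   hyperplane x_i = 0 only. *)
Definition holomorphic_extension_across (i : 'I_n) U f g :=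
  holomorphic_on U g /\ (forall x, U x -> x 0 i != 0 -> g x = f x).

End SeveralComplexVariables.

(* Main.v *)
From HB Require Import structures.
Require Import Defs.
From mathcomp Require Import all_boot all_order all_algebra.
From mathcomp Require Import complex ring lra.
From mathcomp Require Import all_classical all_reals all_analysis.

(** An integral-free route to the little complex analysis that is needed.
    Averages of [f] over the edges of a parallelogram are replaced by trapezoidal
    sums along dyadic subdivisions.  These are exactly additive under
    subdivision and exact on affine functions, so Goursat's bisection argument
    shows that the boundary sums tend to 0 for a function that is merely complex
    differentiable.  In logarithmic coordinates the means over two concentric
    circles thus become asymptotically equal, which gives the Cauchy estimate
    for [f'].  Applied to [f (. + h) - f] the estimate shows that [f'] is
    Lipschitz, hence a second order Taylor bound with a constant depending only on
    [sup |f|]; restricting to complex lines, the same bound holds in several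
    variables.  Consequently a pointwise limit of uniformly bounded holomorphic
    functions is holomorphic.  Partial derivatives are such limits (of difference
    quotients), and so is [f / x_i] when [f] vanishes on [x_i = 0] (of Riemann sums
    of [\int_0^1 (partial i f)(.., s x_i, ..) ds]).

    By invariance, [zeta * (partial i phi)(zeta x_i) = (partial i phi)(x_i)]; if
    [partial i phi = x_i^j g] with [j + 1 < r], choosing [zeta^(j+1) <> 1] shows
    that [g] vanishes on [x_i = 0], so that [x_i] can be divided out once more.
    Hence [partial i phi = x_i^(r-1) g] with [g] holomorphic, and everything is read
    off this factorization: [Delta phi] extends by [g / r]. *)

Import Order.TTheory GRing.Theory Num.Theory.
Import numFieldNormedType.Exports.
Set Implicit Arguments.
Unset Strict Implicit.
Unset Printing Implicit Defensive.

Local Open Scope complex_scope.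
Local Open Scope classical_set_scope.
Local Open Scope ring_scope.

(** * Real-valued norms *)

Section RealNorm.
Context {R : realType}.
Local Notation C := (Cplx R).

(** Norms take values in [C], whose order is only partial. Since a norm is real, its real part loses
    nothing, and real linear arithmetic becomes available. *)
Definition rnorm {V : normedModType C} (v : V) : R := complex.Re `|v|.

Lemma rnormE {V : normedModType C} (v : V) : `|v| = (rnorm v)%:C.
Proof. by rewrite /rnorm RRe_real // normr_real. Qed.

Lemma rnorm_ge0 {V : normedModType C} (v : V) : 0 <= rnorm v.
Proof. by rewrite -lecR -rnormE normr_ge0. Qed.

Lemma ler_rnormD {V : normedModType C} (u v : V) :
  rnorm (u + v) <= rnorm u + rnorm v.
Proof. by rewrite -lecR rmorphD /= -!rnormE ler_normD. Qed.

Lemma rnormN {V : normedModType C} (v : V) : rnorm (- v) = rnorm v.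
Proof. by rewrite /rnorm normrN. Qed.

Lemma rnorm0 {V : normedModType C} : rnorm (0 : V) = 0.
Proof. by rewrite /rnorm normr0. Qed.

Lemma rnorm_eq0 {V : normedModType C} (v : V) : (rnorm v == 0) = (v == 0).
Proof. by rewrite -(inj_eq (@complexI R)) -rnormE normr_eq0. Qed.

Lemma rnorm_gt0 {V : normedModType C} (v : V) : (0 < rnorm v) = (v != 0).
Proof. by rewrite lt_def rnorm_ge0 andbT rnorm_eq0. Qed.

Lemma rnormZ {V : normedModType C} (a : C) (v : V) :
  rnorm (a *: v) = rnorm a * rnorm v.
Proof. by apply: (@complexI R); rewrite rmorphM /= -!rnormE normrZ. Qed.

Lemma rnormM (a b : C) : rnorm (a * b) = rnorm a * rnorm b.
Proof. by apply: (@complexI R); rewrite rmorphM /= -!rnormE normrM. Qed.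

Lemma rnorm1 : rnorm (1 : C) = 1.
Proof. by rewrite /rnorm normr1. Qed.

Lemma rnormV (a : C) : rnorm a^-1 = (rnorm a)^-1.
Proof. by apply: (@complexI R); rewrite fmorphV /= -!rnormE normfV. Qed.

Lemma rnormX (a : C) k : rnorm (a ^+ k) = rnorm a ^+ k.
Proof. by apply: (@complexI R); rewrite rmorphXn /= -!rnormE normrX. Qed.

Lemma rnorm_real (x : R) : rnorm (x%:C : C) = `|x|.
Proof. by apply: (@complexI R); rewrite -rnormE normc_def /= expr0n addr0 sqrtr_sqr. Qed.

Lemma rnorm_nat k : rnorm (k%:R : C) = k%:R.
Proof.
by rewrite -[k%:R in LHS](rmorph_nat (real_complex R)) rnorm_real normr_nat.
Qed.

Lemma ler_Re_rnorm (a : C) : `|complex.Re a| <= rnorm a.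
Proof. by rewrite -lecR -rnormE normc_ge_Re. Qed.

Lemma ler_Im_rnorm (a : C) : `|complex.Im a| <= rnorm a.
Proof.
rewrite -lecR -rnormE normc_def lecR -sqrtr_sqr; apply: ler_wsqrtr.
by rewrite lerDr sqr_ge0.
Qed.

Lemma ler_rnorm_ReIm (a : C) :
  rnorm a <= `|complex.Re a| + `|complex.Im a|.
Proof.
rewrite {1}[a](complexE a) (le_trans (ler_rnormD _ _)) // rnormM !rnorm_real.
suff -> : rnorm ('i%C : C) = 1 by rewrite mul1r.
by apply: (@complexI R); rewrite -rnormE normc_def /= expr0n expr1n add0r sqrtr1.
Qed.

Lemma ler_rnorm_sum {V : normedModType C} (I : finType) (F : I -> V) :
  rnorm (\sum_i F i) <= \sum_i rnorm (F i).
Proof.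
elim/big_ind2 : _ => [|x a y b xa yb|//]; first by rewrite rnorm0.
by apply: (le_trans (ler_rnormD _ _)); apply: lerD.
Qed.

(** Balls of row vectors are defined entrywise, which makes the norm a sup norm. For [n = 0] the
    right side is vacuous, hence [0 < e]. *)
Lemma rnorm_lt_coord n (x : 'rV[C]_n) (e : R) : 0 < e ->
  (rnorm x < e) <-> (forall j, rnorm (x 0 j) < e).
Proof.
move=> e0.
have eC : (0 : C) < e%:C by rewrite ltcR.
have E : (rnorm x < e) <-> ball (0 : 'rV[C]_n) (e%:C : C) x.
  by rewrite -ball_normE /ball_ /= sub0r normrN rnormE ltcR.
split=> [/E[_ xe] j|xe].
  by have := xe 0 j; rewrite -ball_normE /= mxE sub0r normrN rnormE ltcR.
apply/E; split=> // i j; rewrite -ball_normE /= mxE sub0r normrN rnormE ltcR.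
by rewrite (ord1 i).
Qed.

Lemma ler_coord_rnorm n (x : 'rV[C]_n) j : rnorm (x 0 j) <= rnorm x.
Proof.
apply/ler_addgt0Pr => e e0; apply/ltW.
have xe : rnorm x < rnorm x + e by rewrite ltrDl.
by move/rnorm_lt_coord : xe; apply; rewrite ltr_wpDl ?rnorm_ge0.
Qed.

Lemma nbhs_rnormP {V : normedModType C} (x : V) (P : set V) :
  (\forall y \near x, P y) <->
  exists2 d : R, 0 < d & forall y, rnorm (y - x) < d -> P y.
Proof.
split=> [/nbhs_ballP [e /= e0 eP]|[d d0 dP]].
  have eE : e = (complex.Re e)%:C by rewrite RRe_real // gtr0_real.
  exists (complex.Re e); first by rewrite -ltcR -eE.
  move=> y xy; apply: eP.
  by rewrite -ball_normE /= eE -normrN opprB rnormE ltcR.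
apply/nbhs_ballP; exists d%:C => /=; first by rewrite ltcR.
by move=> y; rewrite -ball_normE /= -normrN opprB rnormE ltcR; exact: dP.
Qed.

Lemma continuous_rnormP {V W : normedModType C} (f : V -> W) (x : V) :
  {for x, continuous f} <->
  forall e : R, 0 < e -> exists2 d : R, 0 < d &
    forall y, rnorm (y - x) < d -> rnorm (f y - f x) < e.
Proof.
split=> [fx e e0|fx P /(@nbhs_rnormP W (f x) P)[e e0 eP]].
  have H : nbhs (f x) (fun z => rnorm (z - f x) < e).
    by apply/(@nbhs_rnormP W (f x) (fun z => rnorm (z - f x) < e)); exists e.
  exact/(@nbhs_rnormP V x (fun y => rnorm (f y - f x) < e))/(fx _ H).
apply/(@nbhs_rnormP V x (f @^-1` P)).
by have [d d0 dP] := fx e e0; exists d => // y /dP /eP.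
Qed.

(** A positive element of [C] is real, so complex and real tolerances amount to the same. *)
Lemma littleo_rnormP {V W W' : normedModType C} (k : V -> W) (h : V -> W') :
  (forall e : C, 0 < e -> \forall y \near (0 : V), `|k y| <= e * `|h y|) <->
  forall e : R, 0 < e -> exists2 d : R, 0 < d &
    forall y, rnorm y < d -> rnorm (k y) <= e * rnorm (h y).
Proof.
split=> kh e e0.
  have /kh/nbhs_rnormP[d d0 dP] : (0 : C) < e%:C by rewrite ltcR.
  by exists d => // y yd; have := dP y;
     rewrite subr0 !rnormE -rmorphM /= lecR; apply.
have eE : e = (complex.Re e)%:C by rewrite RRe_real // gtr0_real.
have /kh[d d0 dP] : 0 < complex.Re e by rewrite -ltcR -eE.
apply/nbhs_rnormP; exists d => // y; rewrite subr0 => yd.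
by rewrite eE !rnormE -rmorphM /= lecR; apply: dP.
Qed.

Lemma diff_rnorm {V W : normedModType C} (f : V -> W) (a : V) :
  differentiable f a -> forall e : R, 0 < e -> exists2 d : R, 0 < d &
    forall h, rnorm h < d ->
      rnorm (f (a + h) - f a - 'd f a h) <= e * rnorm h.
Proof.
move=> /diff_locally /eqaddoP /littleo_rnormP fa e e0.
have [d d0 dP] := fa e e0; exists d => // h /dP /=.
rewrite !fctE /=.
by rewrite /cst /= opprD addrA [h + a]addrC.
Qed.
End RealNorm.

(** * Linear forms on C^n and completeness of C *)

Section Complex.
Context {R : realType}.
Local Notation C := (Cplx R).

(** A linear form given by its values on the basis, so that a differential can be built from limits
    of coefficients. *)
Definition lincomb n (c : 'I_n -> C) (h : 'rV[C]_n) : C :=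
  \sum_j h 0 j * c j.

Lemma lincomb_is_linear n (c : 'I_n -> C) : linear (lincomb c : _ -> C^o).
Proof.
move=> a u v; rewrite /lincomb scaler_sumr -big_split /=.
by apply: eq_bigr => j _; rewrite !mxE /GRing.scale /= mulrDl mulrA.
Qed.

HB.instance Definition _ n (c : 'I_n -> C) :=
  GRing.isLinear.Build C 'rV[C]_n C _ (lincomb c) (lincomb_is_linear c).

Lemma ler_lincomb n (c : 'I_n -> C) h :
  rnorm (lincomb c h) <= (\sum_j rnorm (c j)) * rnorm h.
Proof.
apply: (le_trans (ler_rnorm_sum _)); rewrite mulr_suml.
by apply: ler_sum => j _; rewrite rnormM mulrC ler_wpM2l ?rnorm_ge0 // ler_coord_rnorm.
Qed.

Lemma lincomb_continuous n (c : 'I_n -> C) : continuous (lincomb c).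
Proof.
move=> h; apply/continuous_rnormP => d d0.
set K := \sum_j rnorm (c j).
have K0 : 0 <= K by apply: sumr_ge0 => j _; exact: rnorm_ge0.
have K1 : 0 < K + 1 by lra.
exists (d / (K + 1)); first exact: divr_gt0.
move=> y; rewrite ltr_pdivlMr // => yd.
rewrite -linearB; apply: (le_lt_trans (ler_lincomb _ _)); rewrite -/K.
by have := rnorm_ge0 (y - h); nra.
Qed.

(** The estimate is a first order expansion with continuous linear part, and [diff_unique]
    identifies that part with the differential. *)
Lemma differentiable_lincomb n (f : 'rV[C]_n -> C) a (c : 'I_n -> C) :
  (forall e : R, 0 < e -> exists2 d : R, 0 < d & forall h, rnorm h < d ->
     rnorm (f (a + h) - f a - lincomb c h) <= e * rnorm h) ->
  differentiable f a.
Proof.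
move=> fa.
have fo : f \o shift a = cst (f a) + lincomb c +o_ (0 : 'rV[C]_n) id.
  apply/eqaddoP; apply/(@littleo_rnormP R 'rV[C]_n C 'rV[C]_n) => e e0.
  have [d d0 dP] := fa e e0; exists d => // h /dP.
  by rewrite !fctE /cst /= opprD addrA [h + a]addrC.
apply/diff_locallyP.
have E := diff_unique (@lincomb_continuous n c) fo.
by rewrite E; split=> //; exact: lincomb_continuous.
Qed.

(** Completeness of [R], applied to the real and imaginary parts. *)
Lemma ccauchy_cvg (u : nat -> C) :
  (forall e : R, 0 < e -> exists N, forall k l, (N <= k)%N -> (N <= l)%N ->
     rnorm (u k - u l) <= e) ->
  exists l, forall e : R, 0 < e -> exists N, forall k, (N <= k)%N ->
     rnorm (u k - l) <= e.
Proof.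
move=> cu.
have cv (g : C -> R) : (forall a b, g (a - b) = g a - g b) ->
    (forall a, `|g a| <= rnorm a) ->
    exists l, forall e : R, 0 < e -> exists N, forall k, (N <= k)%N ->
      `|g (u k) - l| <= e.
  move=> gB gn.
  have /cauchy_cvgP gl : cauchy ((fun k => g (u k)) @ \oo).
    apply: cauchy_exP => e e0.
    have [N NP] := cu (e / 2) ltac:(by rewrite divr_gt0).
    exists (g (u N)); exists N => // k /= Nk.
    rewrite -ball_normE /= -gB; apply: (le_lt_trans (gn _)).
    by have := NP N k (leqnn _) Nk; lra.
  exists (lim ((fun k => g (u k)) @ \oo)) => e e0.
  have /cvgrPdist_le/(_ e e0)[N _ NP] := gl.
  by exists N => k /NP; rewrite distrC.
have [|a|x xP] := cv (@complex.Re R); first by case=> ? ? [].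
  exact: ler_Re_rnorm.
have [|a|y yP] := cv (@complex.Im R); first by case=> ? ? [].
  exact: ler_Im_rnorm.
exists (x +i* y) => e e0.
have [N NP] := xP (e / 2) ltac:(by rewrite divr_gt0).
have [M MP] := yP (e / 2) ltac:(by rewrite divr_gt0).
exists (maxn N M) => k; rewrite geq_max => /andP[/NP xk /MP yk].
apply: (le_trans (ler_rnorm_ReIm _)).
by case: (u k) xk yk => ? ? /=; lra.
Qed.
End Complex.

(** * Goursat's lemma for trapezoidal sums *)

Section Bisection.
Context {R : realType}.
Local Notation C := (Cplx R).

Lemma exists_div_exp2_lt (D e : R) : 0 < e -> exists m, D / 2 ^+ m < e.
Proof.
move=> e0; pose m := Num.bound `|D / e|; exists m.
rewrite ltr_pdivrMr ?exprn_gt0 // mulrC -ltr_pdivrMr //.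
apply: (le_lt_trans (ler_norm _)); apply: (lt_trans (archi_boundP _)) => //.
by rewrite -natrX ltr_nat ltn_expl.
Qed.

(** Iterated choice gives a sequence whose steps are dominated by a geometric series, hence a limit
    [p] with tails at most [2 * D / 2 ^+ m]. [P] is only asserted at the approximating points, not
    at [p]. *)
Lemma bisection (P : C -> nat -> Prop) (D : R) (z0 : C) :
  P z0 0%N ->
  (forall z m, P z m -> exists2 z', P z' m.+1 & rnorm (z' - z) <= D / 2 ^+ m) ->
  exists p, forall m, exists2 z, P z m & rnorm (z - p) <= 2 * D / 2 ^+ m.
Proof.
move=> P0 PS.
have /choice[F FP] : forall zm : C * nat, exists z', P zm.1 zm.2 ->
    P z' zm.2.+1 /\ rnorm (z' - zm.1) <= D / 2 ^+ zm.2.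
  move=> [z m] /=; have [/PS[z' ? ?]|nP] := pselect (P z m).
    by exists z'.
  by exists z.
pose u := fix u m := if m is m'.+1 then F (u m', m') else z0.
have uP m : P (u m) m by elim: m => //= m IH; have [] := FP (u m, m) IH.
have uS m : rnorm (u m.+1 - u m) <= D / 2 ^+ m by have [] := FP (u m, m) (uP m).
have D0 : 0 <= D by have := uS 0%N; have := rnorm_ge0 (u 1%N - u 0%N); lra.
have exp2 m : 0 < 2 ^+ m :> R by rewrite exprn_gt0.
(* The subtracted term makes the geometric bound telescope, so that the induction on [k] closes. *)
have uk m k : rnorm (u (m + k)%N - u m) <= 2 * D / 2 ^+ m - 2 * D / 2 ^+ (m + k).
  elim: k => [|k IH]; first by rewrite addn0 !subrr rnorm0.
  rewrite addnS -(subrKA (u (m + k)%N)); apply: (le_trans (ler_rnormD _ _)).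
  have -> : 2 * D / 2 ^+ (m + k).+1 = D / 2 ^+ (m + k).
    by rewrite exprS; field; rewrite gt_eqF.
  have := uS (m + k)%N.
  have E : 2 * D / 2 ^+ (m + k) = 2 * (D / 2 ^+ (m + k)) by rewrite mulrA.
  by rewrite E in IH; lra.
have ukm m k : (m <= k)%N -> rnorm (u k - u m) <= 2 * D / 2 ^+ m.
  move=> /subnKC <-; apply: (le_trans (uk _ _)).
  by rewrite gerBl divr_ge0 // ?mulr_ge0 // ltW.
have [|p pP] := @ccauchy_cvg R u.
  move=> e e0; have [N Ne] := @exists_div_exp2_lt (2 * D) (e / 2) ltac:(lra).
  exists N => k l /ukm kN /ukm lN.
  rewrite -(subrKA (u N)); apply: (le_trans (ler_rnormD _ _)).
  by rewrite -[rnorm (u N - _)]rnormN opprB; lra.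
exists p => m; exists (u m) => //; apply/ler_addgt0Pr => e e0.
have [N /(_ (maxn N m))] := pP e e0; rewrite leq_maxl => /(_ isT) NP.
rewrite -(subrKA (u (maxn N m))); apply: (le_trans (ler_rnormD _ _)).
by rewrite lerD // -rnormN opprB ukm // leq_maxr.
Qed.

Definition cderiv (f : C -> C) (z d : C) :=
  forall e : R, 0 < e -> exists2 dl : R, 0 < dl & forall h, rnorm h < dl ->
    rnorm (f (z + h) - f z - d * h) <= e * rnorm h.

(* The trapezoidal mean of [f] over the segment from [z] to [z + a], with [2 ^ k]
   panels. *)
Fixpoint edge (f : C -> C) (k : nat) (z a : C) : C :=
  if k is k'.+1 then (edge f k' z (a / 2) + edge f k' (z + a / 2) (a / 2)) / 2
  else (f z + f (z + a)) / 2.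

Lemma edgeB f g k z a :
  edge (fun w => f w - g w) k z a = edge f k z a - edge g k z a.
Proof. by elim: k z a => [|k IH] z a /=; rewrite ?IH; field. Qed.

Lemma edge_affine c d k z a :
  edge (fun w => c * w + d) k z a = c * (z + a / 2) + d.
Proof. by elim: k z a => [|k IH] z a /=; rewrite ?IH; field. Qed.

(** All nodes are iterated midpoints of the two endpoints, so they stay in [S]. *)
Lemma edge_bound (S : C -> Prop) f k z a (K : R) :
  (forall x y, S x -> S y -> S ((x + y) / 2)) ->
  S z -> S (z + a) -> (forall w, S w -> rnorm (f w) <= K) ->
  rnorm (edge f k z a) <= K.
Proof.
move=> Smid Sz Sza fK.
have avg (x y : C) : rnorm x <= K -> rnorm y <= K -> rnorm ((x + y) / 2) <= K.
  move=> xK yK; rewrite rnormM rnormV.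
  rewrite rnorm_nat.
  by have := ler_rnormD x y; lra.
elim: k z a Sz Sza => [|k IH] z a Sz Sza /=; first by apply: avg; exact: fK.
have Sm : S (z + a / 2).
  by rewrite (_ : z + a / 2 = (z + (z + a)) / 2); [exact: Smid|field].
apply: avg; apply: IH => //.
by rewrite -addrA -splitr.
Qed.

(* Stands for the integral of [f] along the boundary of the parallelogram with
   vertices [z], [z + a], [z + a + b], [z + b]. *)
Definition pgram_sum (f : C -> C) k z a b : C :=
  a * (edge f k z a - edge f k (z + b) a) +
  b * (edge f k (z + a) b - edge f k z b).

(** Each inner side is traversed twice, in opposite directions, and cancels. One level is lost
    because [edge] at level [k.+1] averages two halves at level [k]. *)
Lemma pgram_sumS f k z a b :
  pgram_sum f k.+1 z a b =
    pgram_sum f k z (a / 2) (b / 2) +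
    pgram_sum f k (z + a / 2) (a / 2) (b / 2) +
    pgram_sum f k (z + b / 2) (a / 2) (b / 2) +
    pgram_sum f k (z + a / 2 + b / 2) (a / 2) (b / 2).
Proof.
rewrite /pgram_sum /=.
have E1 : z + b + a / 2 = z + a / 2 + b / 2 + b / 2 by field.
have E2 : z + b = z + b / 2 + b / 2 by field.
have E3 : z + a = z + a / 2 + a / 2 by field.
have E4 : z + a + b / 2 = z + a / 2 + b / 2 + a / 2 by field.
have E5 : z + b / 2 + a / 2 = z + a / 2 + b / 2 by field.
have E6 : z + b / 2 + b / 2 + a / 2 = z + a / 2 + b / 2 + b / 2 by field.
have E7 : z + a / 2 + a / 2 + b / 2 = z + a / 2 + b / 2 + a / 2 by field.
by rewrite E1 E2 E3 ?E4 ?E5 ?E6 ?E7; field.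
Qed.

(* [S] is a closed set containing the parallelogram; it keeps the limit point of
   the nested parallelograms inside the domain of differentiability. *)
Lemma goursat (S : C -> Prop) f (z a b : C) :
  (forall p, (forall e : R, 0 < e -> exists2 w, S w & rnorm (w - p) < e) -> S p) ->
  (forall s t : R, 0 <= s <= 1 -> 0 <= t <= 1 -> S (z + s%:C * a + t%:C * b)) ->
  (forall p, S p -> exists d, cderiv f p d) ->
  forall e : R, 0 < e -> exists K, forall k, (K <= k)%N ->
    rnorm (pgram_sum f k z a b) <= e.
Proof.
move=> Sclosed Spgram fS e e0; apply: contrapT => nK.
pose A : R := rnorm a + rnorm b.
have A0 : 0 <= A by rewrite addr_ge0 ?rnorm_ge0.
have exp2 m : 0 < 2 ^+ m :> R by rewrite exprn_gt0.
(* Bad parallelograms of generation [m]: the corner [z'] keeps the piece inside the original one,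
   and the sum exceeds its share [e / 4 ^+ m] for arbitrarily large [k]. *)
pose P z' m := (exists s t : R, [/\ 0 <= s, s + (2 ^+ m)^-1 <= 1, 0 <= t,
      t + (2 ^+ m)^-1 <= 1 & z' = z + s%:C * a + t%:C * b]) /\
  forall K, exists2 k, (K <= k)%N &
    e / 4 ^+ m < rnorm (pgram_sum f k z' (a / 2 ^+ m) (b / 2 ^+ m)).
have [||p pP] := @bisection P A z.
- split.
    by exists 0, 0; rewrite expr0 invr1 add0r lexx; split=> //; rewrite !mul0r !addr0.
  move=> K; apply: contrapT => nk; apply: nK; exists K => k Kk.
  rewrite leNgt; apply/negP => lt; apply: nk; exists k => //.
  by rewrite !expr0 !divr1.
- move=> z' m [[s [t [s0 s1 t0 t1 z'E]]] bad].
  set a' := a / 2 ^+ m in bad; set b' := b / 2 ^+ m in bad.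
  have aE : a / 2 ^+ m.+1 = a' / 2 by rewrite exprS invfM mulrCA mulrC.
  have bE : b / 2 ^+ m.+1 = b' / 2 by rewrite exprS invfM mulrCA mulrC.
  have sumE k : pgram_sum f k.+1 z' a' b' = \sum_(ij : bool * bool)
      pgram_sum f k (z' + ij.1%:R * (a' / 2) + ij.2%:R * (b' / 2)) (a' / 2) (b' / 2).
    rewrite pgram_sumS -(pair_bigA _ (fun i j : bool => pgram_sum f k
      (z' + i%:R * (a' / 2) + j%:R * (b' / 2)) (a' / 2) (b' / 2))) /=.
    have B (F : bool -> C) : \sum_i F i = F true + F false.
      by rewrite (bigD1 true) //= (big_pred1 false) // => -[].
    by rewrite !B /= !mul1r !mul0r !addr0; ring.
  (* Pigeonhole: if each quarter were eventually below a quarter of the bound, the whole would be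
     eventually below the bound. *)
  have [ij ijP] : exists ij : bool * bool, forall K, exists2 k, (K <= k)%N &
     e / 4 ^+ m.+1 < rnorm (pgram_sum f k
        (z' + ij.1%:R * (a' / 2) + ij.2%:R * (b' / 2)) (a' / 2) (b' / 2)).
    apply: contrapT => nij.
    have /choice[K KP] : forall ij : bool * bool, exists K, forall k, (K <= k)%N ->
      rnorm (pgram_sum f k (z' + ij.1%:R * (a' / 2) + ij.2%:R * (b' / 2))
        (a' / 2) (b' / 2)) <= e / 4 ^+ m.+1.
      move=> ij; apply: contrapT => nK'; apply: nij; exists ij => K.
      apply: contrapT => nk; apply: nK'; exists K => k Kk.
      by rewrite leNgt; apply/negP => lt; apply: nk; exists k.
    (* The successor pays for the level lost in [pgram_sumS]. *)
    have [[|k] Kk] := bad (\max_ij K ij).+1; first by [].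
    rewrite sumE ltNge => /negP; apply.
    apply: (le_trans (ler_rnorm_sum _)).
    apply: (@le_trans _ _ (\sum_(ij : bool * bool) e / 4 ^+ m.+1)).
      by apply: ler_sum => ij _; apply: KP; exact: leq_trans (leq_bigmax ij) Kk.
    rewrite sumr_const card_prod card_bool -mulr_natl exprS.
    by rewrite le_eqVlt; apply/orP; left; apply/eqP; field; rewrite gt_eqF // exprn_gt0.
  exists (z' + ij.1%:R * (a' / 2) + ij.2%:R * (b' / 2)).
    split; last by move=> K; rewrite aE bE.
    exists (s + ij.1%:R / 2 ^+ m.+1), (t + ij.2%:R / 2 ^+ m.+1).
    have i0 : 0 < (2 ^+ m.+1)^-1 :> R by rewrite invr_gt0.
    have iE : (2 ^+ m)^-1 = 2 * (2 ^+ m.+1)^-1 :> R.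
      by rewrite exprS invfM mulrA divff ?mul1r.
    have sb (c : bool) (x : R) : 0 <= x -> x + (2 ^+ m)^-1 <= 1 ->
        0 <= x + c%:R / 2 ^+ m.+1 /\ x + c%:R / 2 ^+ m.+1 + (2 ^+ m.+1)^-1 <= 1.
      by rewrite iE; case: c => /=; lra.
    have [? ?] := sb ij.1 s s0 s1; have [? ?] := sb ij.2 t t0 t1.
    split => //; rewrite z'E -aE -bE !rmorphD !rmorphM !fmorphV !rmorphXn /=.
    rewrite !rmorph_nat. by ring.
  rewrite [_ - z'](_ : _ = ij.1%:R * (a' / 2) + ij.2%:R * (b' / 2)); last by ring.
  have cb (c : bool) (x : C) : rnorm (c%:R * (x / 2 ^+ m / 2)) <= rnorm x / 2 ^+ m.
    rewrite !rnormM !rnormV rnormX rnorm_nat rnorm_nat.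
    have : 0 <= rnorm x / 2 ^+ m by rewrite divr_ge0 ?rnorm_ge0 // ltW.
    by case: c => /=; lra.
  apply: (le_trans (ler_rnormD _ _)); rewrite /A mulrDl.
  by apply: lerD; exact: cb.
have Sp : S p.
  apply: Sclosed => d d0; have [m mP] := @exists_div_exp2_lt (2 * A) d d0.
  have [w [[s [t [s0 s1 t0 t1 ->]]] _] wp] := pP m.
  have i0 : 0 < (2 ^+ m)^-1 :> R by rewrite invr_gt0.
  exists (z + s%:C * a + t%:C * b); last exact: le_lt_trans mP.
  by apply: Spgram; lra.
have [c cP] := fS p Sp.
(* The final bound is [6 * A ^+ 2 * e' / 4 ^+ m]; the added [1] keeps the denominator nonzero. *)
pose e' := e / (6 * A ^+ 2 + 1).
have A2 : 0 <= A ^+ 2 by exact: sqr_ge0.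
have e'0 : 0 < e' by rewrite divr_gt0 //; lra.
have [dl dl0 dlP] := cP e' e'0.
have [m mdl] := @exists_div_exp2_lt (3 * A) dl dl0.
have [w [_ bad] wp] := pP m; have [k _] := bad 0%N.
rewrite ltNge => /negP; apply.
set a' := a / 2 ^+ m; set b' := b / 2 ^+ m.
have a'n : rnorm a' = rnorm a / 2 ^+ m by rewrite rnormM rnormV rnormX rnorm_nat.
have b'n : rnorm b' = rnorm b / 2 ^+ m by rewrite rnormM rnormV rnormX rnorm_nat.
have a'b' : rnorm a' + rnorm b' = A / 2 ^+ m by rewrite a'n b'n -mulrDl.
(* The corner [w] is within [2 * A / 2 ^+ m] of [p] and the two sides add up to [A / 2 ^+ m], so the
   disc of radius [r] about [p] contains the small parallelogram. *)
pose r : R := 3 * A / 2 ^+ m.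
pose aff x := c * x + (f p - c * p).
pose g x := f x - aff x.
have gB x : rnorm (x - p) <= r -> rnorm (g x) <= e' * r.
  move=> xr; have := dlP (x - p) (le_lt_trans xr mdl).
  rewrite addrCA subrr addr0 (_ : _ - _ - _ = g x); last by rewrite /g /aff; ring.
  by move=> H; apply: (le_trans H); rewrite ler_pM2l.
have eB x y : rnorm (x - p) <= r -> rnorm (x + y - p) <= r ->
    rnorm (edge g k x y) <= e' * r.
  move=> xr yr; apply: (@edge_bound (fun q => rnorm (q - p) <= r)) => //.
  move=> u v ur vr; rewrite (_ : _ - p = (u - p + (v - p)) / 2); last by field.
  rewrite rnormM rnormV rnorm_nat; have := ler_rnormD (u - p) (v - p).
  by move: ur vr; lra.
(* Affine functions have boundary sum zero, so only the error [g] of the tangent approximation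
   contributes. *)
have -> : pgram_sum f k w a' b' = pgram_sum g k w a' b'.
  by rewrite /pgram_sum /g !edgeB /aff !edge_affine; field.
have rE : r = rnorm a' + rnorm b' + 2 * A / 2 ^+ m by rewrite a'b' /r; field; rewrite gt_eqF.
have a'0 := rnorm_ge0 a'; have b'0 := rnorm_ge0 b'.
have w0 : rnorm (w - p) <= r by rewrite rE; lra.
have w1 : rnorm (w + a' - p) <= r.
  by rewrite addrAC rE; apply: (le_trans (ler_rnormD _ _)); lra.
have w2 : rnorm (w + b' - p) <= r.
  by rewrite addrAC rE; apply: (le_trans (ler_rnormD _ _)); lra.
have w3 : rnorm (w + a' + b' - p) <= r.
  rewrite (_ : _ - p = w - p + (a' + b')); last by ring.
  rewrite rE; apply: (le_trans (ler_rnormD _ _)).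
  by have := ler_rnormD a' b'; lra.
have w3' : rnorm (w + b' + a' - p) <= r by rewrite (addrAC w).
apply: (@le_trans _ _ (2 * (rnorm a' + rnorm b') * (e' * r))).
  apply: (le_trans (ler_rnormD _ _)); rewrite (rnormM a') (rnormM b').
  have E1 := ler_rnormD (edge g k w a') (- edge g k (w + b') a').
  have E2 := ler_rnormD (edge g k (w + a') b') (- edge g k w b').
  rewrite rnormN in E1; rewrite rnormN in E2.
  have := eB w a' w0 w1; have := eB (w + b') a' w2 w3'.
  have := eB (w + a') b' w1 w3; have := eB w b' w0 w2 => F1 F2 F3 F4.
  have G1 : rnorm (edge g k w a' - edge g k (w + b') a') <= 2 * (e' * r) by lra.
  have G2 : rnorm (edge g k (w + a') b' - edge g k w b') <= 2 * (e' * r) by lra.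
  rewrite (_ : 2 * (rnorm a' + rnorm b') * (e' * r) =
    rnorm a' * (2 * (e' * r)) + rnorm b' * (2 * (e' * r))); last by ring.
  by apply: lerD; apply: ler_wpM2l.
rewrite a'b' /r /e'.
have -> : 4 ^+ m = 2 ^+ m * 2 ^+ m :> R by rewrite -exprMn; congr (_ ^+ _); ring.
set X := 2 ^+ m.
rewrite (_ : 2 * (A / X) * (e / (6 * A ^+ 2 + 1) * (3 * A / X)) =
   e / (X * X) * (6 * A ^+ 2 / (6 * A ^+ 2 + 1))); last first.
  have X0 : X != 0 by rewrite lt0r_neq0 // exp2.
  have A0' : 6 * A ^+ 2 + 1 != 0 by rewrite lt0r_neq0 //; lra.
  by field; rewrite X0 A0'.
apply: ler_piMr; last by rewrite ler_pdivrMr; lra.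
by apply: divr_ge0; [exact: ltW|apply: mulr_ge0; apply: ltW; exact: exp2].
Qed.
End Bisection.

(** * The complex exponential *)

Section ComplexExp.
Context {R : realType}.
Local Notation C := (Cplx R).

Lemma differentiable_cderiv (f : C -> C) (z : C) :
  differentiable f z -> cderiv f z ('d f z 1).
Proof.
move=> fz e e0; have [d d0 dP] := diff_rnorm fz e0.
exists d => // h /dP.
suff -> : 'd f z h = 'd f z 1 * h by [].
by rewrite -{1}[h]mulr1 -[h * 1]/(h *: 1) linearZ mulrC.
Qed.

Definition mulmap (d h : C) : C := d * h.

Lemma mulmap_is_linear (d : C) : linear (mulmap d : C^o -> C^o).
Proof.
by move=> a u v; rewrite /mulmap mulrDr /GRing.scale /= mulrCA.
Qed.

HB.instance Definition _ (d : C) :=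
  GRing.isLinear.Build C C C _ (mulmap d) (mulmap_is_linear d).

Lemma mulmap_continuous (d : C) : continuous (mulmap d).
Proof. by move=> z; apply: continuousM; [exact: cst_continuous|]. Qed.

Lemma cderiv_differentiable (f : C -> C) (z d : C) :
  cderiv f z d -> differentiable f z.
Proof.
move=> fz.
have fo : f \o shift z = cst (f z) + mulmap d +o_ (0 : C) id.
  apply/eqaddoP; apply/(@littleo_rnormP R C C C) => e e0.
  have [dl dl0 dP] := fz e e0; exists dl => // h /dP.
  by rewrite !fctE /cst /= opprD addrA [h + z]addrC.
apply/diff_locallyP.
have E := diff_unique (@mulmap_continuous d) fo.
by rewrite E; split=> //; exact: mulmap_continuous.
Qed.

Lemma is_derive_expansion (f : R -> R) (x d : R) : is_derive x 1 f d ->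
  forall e : R, 0 < e -> exists2 dl : R, 0 < dl & forall h, `|h| < dl ->
    `|f (x + h) - f x - d * h| <= e * `|h|.
Proof.
move=> [/derivable_nbhs + fd] e e0; rewrite fd => /eqaddoP/(_ e e0)/nbhs_ballP.
move=> [dl dl0 dP]; exists dl => // h hdl.
have /dP : ball (0 : R) dl h by rewrite -ball_normE /= sub0r normrN.
rewrite /= !fctE /cst /= opprD addrA.
by rewrite /GRing.scale /= mulr1 (addrC h) (mulrC h).
Qed.

Definition cexp (z : C) : C :=
  (expR (complex.Re z))%:C * (cos (complex.Im z) +i* sin (complex.Im z)).

Lemma cexpD a b : cexp (a + b) = cexp a * cexp b.
Proof.
case: a b => [a a'] [b b']; apply/eqP; rewrite eq_complex /= expRD cosD sinD.
by apply/andP; split; apply/eqP; ring.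
Qed.

Lemma cexp_real (x : R) : cexp x%:C = (expR x)%:C.
Proof. by rewrite /cexp /= cos0 sin0 complexr0 mulr1. Qed.

Lemma cexp0 : cexp 0 = 1.
Proof. by have := cexp_real 0; rewrite expR0. Qed.

Definition c2pi : C := 0 +i* (pi *+ 2).

Lemma cexp_2pi : cexp c2pi = 1.
Proof. by rewrite /cexp /= expR0 mul1r cos2pi sin2pi. Qed.

Lemma rnorm_cexp z : rnorm (cexp z) = expR (complex.Re z).
Proof.
rewrite /cexp rnormM rnorm_real ger0_norm ?expR_ge0 //.
rewrite [X in _ * X](_ : _ = 1) ?mulr1 //.
by apply: (@complexI R); rewrite -rnormE normc_def /= cos2Dsin2 sqrtr1.
Qed.

Lemma cderiv_cexp0 : cderiv cexp 0 1.
Proof.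
move=> e e0.
(* The real and imaginary errors below add up to at most [9 * e' * N], where [N] is the norm of [h];
   [e' <= 1] serves to bound [expR x] by [3]. *)
have [e' e'0 [e'1 e'e]] : exists2 e' : R, 0 < e' & e' <= 1 /\ e' <= e / 10.
  exists (Num.min 1 (e / 10)); first by rewrite lt_min ltr01 divr_gt0.
  by rewrite !ge_min !lexx orbT.
have [dx dx0 xP] := @is_derive_expansion expR 0 _ (is_derive_expR 0) e' e'0.
have [dc dc0 cP] := @is_derive_expansion cos 0 _ (is_derive_cos 0) e' e'0.
have [ds ds0 sP] := @is_derive_expansion sin 0 _ (is_derive_sin 0) e' e'0.
exists (Num.min (Num.min dx dc) (Num.min ds e')); first by rewrite !lt_min dx0 dc0 ds0.
move=> h; rewrite !lt_min => /andP[/andP[hx hc] /andP[hs he]].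
have xh := ler_Re_rnorm h; have yh := ler_Im_rnorm h.
have {}xP := xP (complex.Re h) (le_lt_trans xh hx).
have {}cP := cP (complex.Im h) (le_lt_trans yh hc).
have {}sP := sP (complex.Im h) (le_lt_trans yh hs).
move: xP cP sP; rewrite !add0r sin0 cos0 expR0 oppr0 mul0r !mul1r !addr0 !subr0 => xP cP sP.
have N0 := rnorm_ge0 h.
rewrite cexp0; apply: (le_trans (ler_rnorm_ReIm _)).
case: h hx hc hs he xh yh xP cP sP N0 => x y /=; set N := rnorm _.
move=> _ _ _ he xh yh; set E := expR x => xP cP sP N0.
rewrite !mul0r !subr0 !addr0.
have e'x : e' * `|x| <= e' * N by rewrite ler_pM2l.
have e'y : e' * `|y| <= e' * N by rewrite ler_pM2l.
have e'N : e' * N <= N by rewrite ler_piMl.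
have E3 : `|E| <= 3.
  rewrite (_ : E = (E - 1 - x) + (1 + x)); last by ring.
  apply: (le_trans (ler_normD _ _)); have := ler_normD 1 x.
  by rewrite normr1; lra.
have E1 : `|E - 1| <= 2 * N.
  rewrite (_ : E - 1 = (E - 1 - x) + x); last by ring.
  by apply: (le_trans (ler_normD _ _)); lra.
have F1 : `|E * (cos y - 1)| <= 3 * (e' * N).
  by rewrite normrM ler_pM // (le_trans cP).
have F2 : `|E * (sin y - y)| <= 3 * (e' * N).
  by rewrite normrM ler_pM // (le_trans sP).
have F3 : `|(E - 1) * y| <= 2 * N * e'.
  by rewrite normrM ler_pM //; lra.
rewrite (_ : _ - x = E * (cos y - 1) + (E - 1 - x)); last by ring.
rewrite (_ : _ - y = E * (sin y - y) + (E - 1) * y); last by ring.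
have G1 := ler_normD (E * (cos y - 1)) (E - 1 - x).
have G2 := ler_normD (E * (sin y - y)) ((E - 1) * y).
have G3 : e' * N <= e / 10 * N by rewrite ler_wpM2r.
by have := mulr_ge0 (ltW e0) N0; lra.
Qed.
(** The functional equation transports the derivative at [0] to [z]. *)
Lemma differentiable_cexp z : differentiable cexp z.
Proof.
apply: (@cderiv_differentiable _ _ (cexp z)) => e e0.
have n0 : 0 < rnorm (cexp z) by rewrite rnorm_cexp expR_gt0.
have [d d0 dP] := cderiv_cexp0 (divr_gt0 e0 n0); exists d => // h /dP.
rewrite add0r cexpD mul1r cexp0.
rewrite (_ : _ - cexp z * h = cexp z * (cexp h - 1 - h)); last by ring.
by rewrite rnormM mulrAC ler_pdivlMr // mulrC.
Qed.
End ComplexExp.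

(** * Cauchy's estimate *)

Section CauchyEstimate.
Context {R : realType}.
Local Notation C := (Cplx R).

Lemma eq_edge (f g : C -> C) k z a : f =1 g -> edge f k z a = edge g k z a.
Proof. by move=> fg; elim: k z a => [|k IH] z a /=; rewrite ?IH ?fg. Qed.

Lemma edge_shift (f : C -> C) k z a b :
  edge f k (z + b) a = edge (fun w => f (w + b)) k z a.
Proof.
elim: k z a => [|k IH] z a /=; first by rewrite addrAC.
by rewrite addrAC !IH.
Qed.

(* The mean of [G] over [2 ^ k] equidistant points of the circle [|w| = s], since
   [cexp] wraps the segment from [ln s] to [ln s + 2 pi i] once around it. *)
Definition circ_mean (G : C -> C) k (s : R) : C :=
  edge (fun w => G (cexp w)) k (ln s)%:C c2pi.

(** [cexp] wraps the rectangle between [ln s] and [ln t] of height [2 pi] onto the annulus, so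
    Goursat's lemma applies to [G] composed with [cexp]. *)
Lemma circ_mean_annulus (G : C -> C) (s t : R) : 0 < s -> s <= t ->
  (forall w, s <= rnorm w <= t -> differentiable G w) ->
  forall e : R, 0 < e -> exists K, forall k, (K <= k)%N ->
    rnorm (circ_mean G k t - circ_mean G k s) <= e.
Proof.
move=> s0 st GD e e0; have t0 : 0 < t := lt_le_trans s0 st.
have c0 : 0 < rnorm (c2pi : C).
  rewrite rnorm_gt0; apply/eqP => -[] /eqP.
  by rewrite mulrn_eq0 /= gt_eqF // pi_gt0.
pose H w := G (cexp w).
have lnst : ln s <= ln t by rewrite ler_ln.
have [|x y|p|K KP] := @goursat R (fun w => ln s <= complex.Re w <= ln t) H (ln s)%:C
    (ln t - ln s)%:C c2pi _ _ _ _ (mulr_gt0 c0 e0).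
- move=> p pP; apply/andP; split; rewrite leNgt; apply/negP => lt.
    have [w /andP[sw _] wp] := pP (ln s - complex.Re p) ltac:(by rewrite subr_gt0).
    have := ler_Re_rnorm (w - p); have := ler_norm (complex.Re (w - p)).
    by rewrite raddfB /=; lra.
  have [w /andP[_ wt] wp] := pP (complex.Re p - ln t) ltac:(by rewrite subr_gt0).
  have := ler_Re_rnorm (w - p); have := ler_norm (- complex.Re (w - p)).
  by rewrite normrN raddfB /=; lra.
- move=> /andP[x0 x1] /andP[y0 y1] /=.
  rewrite !mul0r !mulr0 !subr0 !addr0.
  have lnB : 0 <= ln t - ln s by rewrite subr_ge0.
  have x1' : 0 <= 1 - x by rewrite subr_ge0.
  by have := mulr_ge0 x0 lnB; have := mulr_ge0 x1' lnB; lra.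
- move=> /andP[sp pt]; eexists; apply: differentiable_cderiv.
  apply: (@differentiable_comp _ _ _ _ cexp G); first exact: differentiable_cexp.
  apply: GD; rewrite rnorm_cexp -[s]lnK // -[t]lnK // !ler_expR.
  by rewrite sp.
exists K => k /KP; rewrite /pgram_sum.
(* By periodicity the two horizontal sides cancel; what remains is [c2pi] times the difference of
   the circular means. *)
have -> : edge H k ((ln s)%:C + c2pi) (ln t - ln s)%:C =
    edge H k (ln s)%:C (ln t - ln s)%:C.
  by rewrite edge_shift; apply: eq_edge => w; rewrite /H cexpD cexp_2pi mulr1.
rewrite subrr mulr0 add0r rnormM ler_pM2l //.
by rewrite -rmorphD /= (_ : ln s + _ = ln t) //; ring.
Qed.

Lemma circ_mean_near (G : C -> C) (L : C) k (s K : R) : 0 < s ->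
  (forall w, rnorm w = s -> rnorm (G w - L) <= K) ->
  rnorm (circ_mean G k s - L) <= K.
Proof.
move=> s0 GK.
have -> : circ_mean G k s - L = edge (fun w => G (cexp w) - (0 * w + L)) k (ln s)%:C c2pi.
  by rewrite edgeB edge_affine mul0r add0r.
apply: (@edge_bound _ (fun w => complex.Re w = ln s)).
- move=> x y xs ys; rewrite (_ : complex.Re _ = (complex.Re x + complex.Re y) / 2).
    by rewrite xs ys; field.
  rewrite -[2 : C](rmorph_nat (real_complex R)) -fmorphV.
  by case: x y {xs ys} => ? ? [? ?] /=; rewrite mulr0 subr0.
- by [].
- by rewrite /= addr0.
by move=> w ws; rewrite mul0r add0r; apply: GK; rewrite rnorm_cexp ws lnK.
Qed.

(** Means over small circles are close to [L], the mean over [|w| = s] is at most [K], and for fine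
    subdivisions the two means nearly agree. *)
Lemma removable_bound (G : C -> C) (L : C) (rho s K : R) : 0 < s -> s < rho ->
  (forall w, 0 < rnorm w < rho -> differentiable G w) ->
  (forall e : R, 0 < e -> exists2 d : R, 0 < d &
     forall w, 0 < rnorm w < d -> rnorm (G w - L) <= e) ->
  (forall w, rnorm w = s -> rnorm (G w) <= K) ->
  rnorm L <= K.
Proof.
move=> s0 srho GD GL GK; apply/ler_addgt0Pr => e e0.
have [d d0 dP] := GL (e / 2) ltac:(by rewrite divr_gt0).
pose t := Num.min s (d / 2).
have t0 : 0 < t by rewrite lt_min s0 divr_gt0.
have [ts td] : t <= s /\ t < d.
  by rewrite ge_min lexx gt_min; split=> //; apply/orP; right; lra.
have [//|//|||k /(_ k (leqnn k)) kP] := @circ_mean_annulus G t s _ _ _ (e / 2).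
- by move=> w /andP[tw ws]; apply: GD; rewrite (lt_le_trans t0) // (le_lt_trans ws).
- by rewrite divr_gt0.
have kt : rnorm (circ_mean G k t - L) <= e / 2.
  by apply: circ_mean_near => // w wt; apply: dP; rewrite wt t0.
have ks : rnorm (circ_mean G k s - 0) <= K.
  by apply: circ_mean_near => // w ws; rewrite subr0; apply: GK.
rewrite subr0 in ks.
rewrite (_ : L = circ_mean G k s - (circ_mean G k s - circ_mean G k t)
   - (circ_mean G k t - L)); last by ring.
have := ler_rnormD (circ_mean G k s - (circ_mean G k s - circ_mean G k t))
  (- (circ_mean G k t - L)).
have := ler_rnormD (circ_mean G k s) (- (circ_mean G k s - circ_mean G k t)).
by rewrite !rnormN; lra.
Qed.

(** The difference quotient at [c] is holomorphic on the punctured disc, tends to [d], and is at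
    most [M / s] on the circle of radius [s]. *)
Lemma cauchy_estimate (f : C -> C) (c d : C) (rho s M : R) : 0 < s -> s < rho ->
  (forall w, rnorm (w - c) < rho -> differentiable f w) ->
  (forall w, rnorm (w - c) = s -> rnorm (f w - f c) <= M) ->
  cderiv f c d -> rnorm d <= M / s.
Proof.
move=> s0 srho fD fM fd.
apply: (@removable_bound (fun w => w^-1 * (f (c + w) - f c)) d rho s) => //.
- move=> w /andP[w0 wr]; apply: differentiableM.
    by apply: differentiableV => //; rewrite -rnorm_gt0.
  apply: differentiableB => //.
  apply: (@differentiable_comp _ _ _ _ (fun w => c + w) f).
    exact: differentiableD.
  by apply: fD; rewrite addrAC subrr add0r.
- move=> e e0; have [dl dl0 dlP] := fd e e0; exists dl => // w /andP[w0 wd].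
  have wn : w != 0 by rewrite -rnorm_gt0.
  rewrite (_ : _ - d = w^-1 * (f (c + w) - f c - d * w)); last by field.
  by rewrite rnormM rnormV ler_pdivrMl // [leRHS]mulrC dlP.
- move=> w ws; rewrite rnormM rnormV ws mulrC ler_pM2r ?invr_gt0 //.
  by apply: fM; rewrite addrAC subrr add0r.
Qed.

(** If the increment over a segment is too large, it is too large over one of the halves; bisection
    contradicts the derivative bound at the limit point. *)
Lemma mean_value_le (f : C -> C) (z a : C) (K : R) :
  (forall w, rnorm (w - z) <= rnorm a -> exists2 d, cderiv f w d & rnorm d <= K) ->
  rnorm (f (z + a) - f z) <= K * rnorm a.
Proof.
move=> fK; have [->|a0] := eqVneq a 0.
  by rewrite addr0 subrr rnorm0 mulr0.
have an : 0 < rnorm a by rewrite rnorm_gt0.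
apply/ler_addgt0Pr => e e0; rewrite leNgt; apply/negP => lt.
(* The endpoints [w] and [w + b] of a late segment lie within [2] and [3] times [rnorm b] of [p];
   their errors add up to [5 * e' * rnorm b]. *)
pose e' : R := e / (5 * rnorm a).
have e'0 : 0 < e' by rewrite divr_gt0 // mulr_gt0.
pose K' := K + 5 * e'.
have rb m : rnorm (a / 2 ^+ m) = rnorm a / 2 ^+ m.
  by rewrite rnormM rnormV rnormX rnorm_nat.
have bb m : a / 2 ^+ m = a / 2 ^+ m.+1 + a / 2 ^+ m.+1.
  by rewrite exprS invfM; field; rewrite expf_neq0 // pnatr_eq0.
have rbb m : rnorm (a / 2 ^+ m) = rnorm (a / 2 ^+ m.+1) + rnorm (a / 2 ^+ m.+1).
  by rewrite !rb exprS invfM; field; rewrite expf_neq0.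
pose P w m := rnorm (w - z) + rnorm (a / 2 ^+ m) <= rnorm a /\
  K' * rnorm (a / 2 ^+ m) < rnorm (f (w + a / 2 ^+ m) - f w).
have [||p pP] := @bisection R P (rnorm a) z.
- split; first by rewrite subrr rnorm0 add0r expr0 divr1.
  rewrite expr0 !divr1; apply: le_lt_trans lt.
  by rewrite /K' /e' le_eqVlt; apply/orP; left; apply/eqP; field; rewrite gt_eqF.
- move=> w m [wz bad]; rewrite rbb in wz; rewrite (rbb m) mulrDr (bb m) addrA in bad.
  rewrite -rb (rbb m) /P; have := rnorm_ge0 (a / 2 ^+ m.+1).
  move: wz bad; set b := a / 2 ^+ m.+1 => wz bad b0.
  have [lt1|le1] := ltP (K' * rnorm b) (rnorm (f (w + b) - f w)).
    by exists w; [split=> //; lra|rewrite subrr rnorm0; lra].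
  exists (w + b); last by rewrite addrAC subrr add0r; lra.
  split; first by have := ler_rnormD (w - z) b; rewrite addrAC; lra.
  have := ler_rnormD (f (w + b + b) - f (w + b)) (f (w + b) - f w).
  by rewrite subrKA; lra.
have pz : rnorm (p - z) <= rnorm a.
  apply/ler_addgt0Pr => d d0.
  have [m md] := @exists_div_exp2_lt _ (2 * rnorm a) d d0.
  have [w [wz _] wp] := pP m; have b0 := rnorm_ge0 (a / 2 ^+ m).
  have := ler_rnormD (p - w) (w - z); rewrite subrKA -[rnorm (p - w)]rnormN opprB.
  by lra.
have [d dP dK] := fK p pz.
have [dl dl0 dlP] := dP e' e'0.
have [m mdl] := @exists_div_exp2_lt _ (3 * rnorm a) dl dl0.
have [w [wz bad] wp] := pP m.
rewrite -!mulrA -rb in wp mdl; move: wz bad wp mdl; have := rnorm_ge0 (a / 2 ^+ m).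
set b := a / 2 ^+ m => b0 wz bad wp mdl.
have errP q : rnorm (q - p) <= 3 * rnorm b ->
    rnorm (f q - f p - d * (q - p)) <= e' * rnorm (q - p).
  by move=> /le_lt_trans /(_ mdl) /dlP; rewrite (addrC p) subrK.
have w1 := errP w ltac:(lra).
have wb : rnorm (w + b - p) <= 3 * rnorm b.
  by have := ler_rnormD (w - p) b; rewrite addrAC; lra.
have w2 := errP (w + b) wb.
suff : rnorm (f (w + b) - f w) <= K' * rnorm b by rewrite leNgt bad.
rewrite (_ : f (w + b) - f w = d * b + (f (w + b) - f p - d * (w + b - p))
   - (f w - f p - d * (w - p))); last by ring.
apply: (le_trans (ler_rnormD _ _)); rewrite rnormN.
have := ler_rnormD (d * b) (f (w + b) - f p - d * (w + b - p)).
have G0 : rnorm (d * b) <= K * rnorm b by rewrite rnormM ler_wpM2r.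
have G1 : e' * rnorm (w - p) <= e' * (2 * rnorm b) by rewrite ler_pM2l.
have G2 : e' * rnorm (w + b - p) <= e' * (3 * rnorm b) by rewrite ler_pM2l.
by rewrite /K'; lra.
Qed.

End CauchyEstimate.

(** * Second order Taylor bounds *)

Section Taylor.
Context {R : realType}.
Local Notation C := (Cplx R).

Lemma cderivB (f g : C -> C) z d d' : cderiv f z d -> cderiv g z d' ->
  cderiv (fun w => f w - g w) z (d - d').
Proof.
move=> fd gd e e0; have e20 : 0 < e / 2 by rewrite divr_gt0.
have [u u0 uP] := fd _ e20; have [v v0 vP] := gd _ e20.
exists (Num.min u v); first by rewrite lt_min u0.
move=> h; rewrite lt_min => /andP[/uP hu /vP hv].
rewrite (_ : _ - _ - _ * h = (f (z + h) - f z - d * h) -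
  (g (z + h) - g z - d' * h)); last by ring.
by apply: (le_trans (ler_rnormD _ _)); rewrite rnormN; lra.
Qed.

Lemma cderiv_affine (c d z : C) : cderiv (fun w => c + d * w) z d.
Proof.
move=> e e0; exists 1 => // h _.
rewrite (_ : _ - _ * h = 0); last by ring.
by rewrite rnorm0 mulr_ge0 ?rnorm_ge0 // ltW.
Qed.

Lemma cderiv_shift (f : C -> C) z b d : cderiv f (z + b) d ->
  cderiv (fun w => f (w + b)) z d.
Proof.
move=> fd e /fd[dl dl0 dlP]; exists dl => // h /dlP.
by rewrite (addrAC z b h).
Qed.

Section OneVariable.
Variables (f : C -> C) (c : C) (rho M : R).
Hypotheses (rho0 : 0 < rho)
  (fD : forall w, rnorm (w - c) < 4 * rho -> differentiable f w)
  (fM : forall w, rnorm (w - c) < 4 * rho -> rnorm (f w) <= M).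

Let triangle w v (r s t : R) : rnorm (w - v) <= r -> rnorm (v - c) < s -> r + s <= t ->
  rnorm (w - c) < t.
Proof. by have := ler_rnormD (w - v) (v - c); rewrite subrKA; lra. Qed.

Lemma ler_cderiv w d : rnorm (w - c) < 2 * rho -> cderiv f w d ->
  rnorm d <= 2 * M / rho.
Proof.
have r0 := rho0; move=> wc fd; apply: (@cauchy_estimate R f w d (2 * rho)) => //; first by lra.
  by move=> v vw; apply: fD; apply: triangle (ltW vw) wc _; lra.
move=> v vw; have vc : rnorm (v - c) < 4 * rho.
  by apply: (@triangle _ w rho (2 * rho)) => //; [rewrite vw|lra].
have := ler_rnormD (f v) (- f w); rewrite rnormN.
by have := fM vc; have := fM (_ : rnorm (w - c) < 4 * rho); lra.
Qed.

Lemma ler_increment w h : rnorm (w - c) < rho -> rnorm h <= rho ->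
  rnorm (f (w + h) - f w) <= 2 * M / rho * rnorm h.
Proof.
have r0 := rho0; move=> wc hr; apply: mean_value_le => v vw.
have vc : rnorm (v - c) < 2 * rho by apply: triangle vw wc _; lra.
exists ('d f v 1); first by apply: differentiable_cderiv; apply: fD; lra.
apply: ler_cderiv (vc) _.
by apply: differentiable_cderiv; apply: fD; lra.
Qed.

(* Cauchy's estimate for [f (. + h) - f]. *)
Lemma ler_cderivB h d d' : rnorm h < rho -> cderiv f c d -> cderiv f (c + h) d' ->
  rnorm (d' - d) <= 8 * M / rho ^+ 2 * rnorm h.
Proof.
have r0 := rho0; move=> hr fd fd'.
rewrite (_ : 8 * M / rho ^+ 2 * rnorm h =
  2 * (2 * M / rho * rnorm h) / (rho / 2)); last by field; rewrite gt_eqF.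
apply: (@cauchy_estimate R (fun w => f (w + h) - f w) c _ rho).
- by rewrite divr_gt0.
- by lra.
- move=> w wc; apply: differentiableB; last by apply: fD; lra.
  apply: (@differentiable_comp _ _ _ _ (fun w => w + h) f).
    exact: differentiableD.
  by apply: fD; have := ler_rnormD (w - c) h; rewrite addrAC; lra.
- move=> w wc; have wc' : rnorm (w - c) < rho by lra.
  have := ler_rnormD (f (w + h) - f w) (- (f (c + h) - f c)).
  have := ler_increment wc' (ltW hr).
  have := @ler_increment c h; rewrite subrr rnorm0 => /(_ rho0 (ltW hr)).
  by rewrite rnormN; lra.
by apply: cderivB => //; exact: cderiv_shift.
Qed.

(** The function [f w - d * w] has derivative [f' w - f' c], which is of order [|w - c|] by
    [ler_cderivB]; the mean value bound adds the second factor [rnorm h]. *)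
Lemma ler_taylor h d : rnorm h < rho -> cderiv f c d ->
  rnorm (f (c + h) - f c - d * h) <= 8 * M / rho ^+ 2 * rnorm h ^+ 2.
Proof.
have r0 := rho0; move=> hr fd.
have M0 : 0 <= M by apply: le_trans (fM (_ : rnorm (c - c) < _));
  rewrite ?rnorm_ge0 // subrr rnorm0 mulr_gt0.
rewrite (_ : f (c + h) - f c - d * h = (f (c + h) - (0 + d * (c + h))) -
  (f c - (0 + d * c))); last by ring.
rewrite expr2 mulrA; apply: (@mean_value_le _ (fun w => f w - (0 + d * w))).
move=> w wc; have fw : cderiv f w ('d f w 1).
  by apply: differentiable_cderiv; apply: fD; lra.
exists ('d f w 1 - d); first by apply: cderivB => //; exact: cderiv_affine.
apply: (@le_trans _ _ (8 * M / rho ^+ 2 * rnorm (w - c))).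
  apply: ler_cderivB => //; first by lra.
  by rewrite addrC subrK.
by rewrite ler_wpM2l // divr_ge0 ?sqr_ge0 // mulr_ge0.
Qed.

End OneVariable.

Section Normed.
Variables (V : normedModType C) (f : V -> C) (a : V) (rho M : R).
Hypotheses (rho0 : 0 < rho)
  (fD : forall w, rnorm (w - a) < 4 * rho -> differentiable f w)
  (fM : forall w, rnorm (w - a) < 4 * rho -> rnorm (f w) <= M).

Lemma cderiv_line h : differentiable f a -> cderiv (fun t => f (a + t *: h)) 0 ('d f a h).
Proof.
move=> fa e e0; have [h0|h0] := eqVneq h 0.
  exists 1 => // t _; rewrite h0 !scaler0 addr0 subrr linear0 mul0r subr0 rnorm0.
  by rewrite mulr_ge0 ?rnorm_ge0 // ltW.
have hn : 0 < rnorm h by rewrite rnorm_gt0.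
have [dl dl0 dlP] := diff_rnorm fa (divr_gt0 e0 hn).
exists (dl / rnorm h); first by rewrite divr_gt0.
move=> t; rewrite ltr_pdivlMr // -rnormZ => /dlP.
rewrite add0r scale0r addr0 linearZ /= [_ * t]mulrC => /le_trans; apply.
by rewrite rnormZ [_ * rnorm h]mulrC mulrA divfK // gt_eqF.
Qed.

(** On the line [a + t *: h] the radius becomes [rho / rnorm h]; at [t = 1] the powers of [rnorm h]
    reappear in the bounds. *)
Let line_hyps h (h0 : h != 0) :
  [/\ 0 < rho / rnorm h,
   forall t : C, rnorm (t - 0) < 4 * (rho / rnorm h) ->
     differentiable (fun t : C => f (a + t *: h)) t &
   forall t : C, rnorm (t - 0) < 4 * (rho / rnorm h) -> rnorm (f (a + t *: h)) <= M].
Proof.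
have hn : 0 < rnorm h by rewrite rnorm_gt0.
have tP (t : C) : rnorm (t - 0) < 4 * (rho / rnorm h) ->
    rnorm (a + t *: h - a) < 4 * rho.
  by rewrite subr0 addrAC subrr add0r rnormZ mulrA ltr_pdivlMr.
split; first by rewrite divr_gt0.
  move=> t /tP tr.
  apply: (@differentiable_comp _ _ _ _ (fun t : C => a + t *: h) f); last exact: fD.
  apply: differentiableD; first exact: differentiable_cst.
  exact: differentiableZl.
by move=> t /tP; exact: fM.
Qed.

Lemma ler_diff_taylor h : rnorm h < rho ->
  rnorm (f (a + h) - f a - 'd f a h) <= 8 * M / rho ^+ 2 * rnorm h ^+ 2.
Proof.
move=> hr; have fa : differentiable f a.
  by apply: fD; rewrite subrr rnorm0 mulr_gt0.
have [h0|h0] := eqVneq h 0.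
  by rewrite h0 addr0 subrr linear0 subr0 !rnorm0 expr0n mulr0.
have hn : 0 < rnorm h by rewrite rnorm_gt0.
have [r0 lD lM] := line_hyps h0.
have := ler_taylor r0 lD lM (h := 1) (d := 'd f a h).
rewrite rnorm1 ltr_pdivlMr // mul1r => /(_ hr (cderiv_line _ fa)).
rewrite add0r scale1r scale0r addr0 mulr1 => /le_trans; apply.
by rewrite le_eqVlt; apply/orP; left; apply/eqP; field; rewrite !gt_eqF.
Qed.

Lemma ler_diff_increment h : rnorm h <= rho ->
  rnorm (f (a + h) - f a) <= 2 * M / rho * rnorm h.
Proof.
move=> hr; have [h0|h0] := eqVneq h 0.
  by rewrite h0 addr0 subrr !rnorm0 mulr0.
have hn : 0 < rnorm h by rewrite rnorm_gt0.
have [r0 lD lM] := line_hyps h0.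
have := ler_increment r0 lD lM (w := 0) (h := 1).
rewrite subr0 rnorm0 rnorm1 ler_pdivlMr // mul1r => /(_ r0 hr).
rewrite add0r scale1r scale0r addr0 => /le_trans; apply.
by rewrite le_eqVlt; apply/orP; left; apply/eqP; field; rewrite !gt_eqF.
Qed.

End Normed.
End Taylor.

(** * Limits, derivatives and quotients of holomorphic functions *)

Section SeveralVariables.
Context {R : realType} {n : nat}.
Local Notation C := (Cplx R).
Implicit Types (f g : 'rV[C]_n -> C) (a v w : 'rV[C]_n).

Lemma ler_rnorm_split (x y m : C) (e : R) :
  rnorm (x - m) <= e / 2 -> rnorm (y - m) <= e / 2 -> rnorm (x - y) <= e.
Proof.
move=> xm ym; rewrite -(subrKA m) (le_trans (ler_rnormD _ _)) //.
by rewrite -[rnorm (m - y)]rnormN opprB; lra.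
Qed.

Lemma diff_lincomb f a h : 'd f a h = lincomb (fun j => 'd f a 'e_j) h.
Proof.
rewrite {1}(row_sum_delta h) linear_sum; apply: eq_bigr => j _.
by rewrite linearZ.
Qed.

Lemma near_eq_differentiable f g a : (\forall w \near a, f w = g w) ->
  differentiable f a -> differentiable g a.
Proof.
move=> /(@nbhs_rnormP _ 'rV[C]_n)[d d0 fg] fa.
apply: (@differentiable_lincomb _ _ _ _ (fun j => 'd f a 'e_j)) => e e0.
have [dl dl0 dlP] := diff_rnorm fa e0.
exists (Num.min d dl); first by rewrite lt_min d0.
move=> h; rewrite lt_min => /andP[hd /dlP]; rewrite diff_lincomb.
rewrite -!fg ?subrr ?rnorm0 //.
by rewrite addrAC subrr add0r.
Qed.

Lemma near_bounded f a : (\forall w \near a, differentiable f w) ->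
  exists rho M : R, 0 < rho /\ forall w, rnorm (w - a) < rho ->
    differentiable f w /\ rnorm (f w) <= M.
Proof.
move=> /(@nbhs_rnormP _ 'rV[C]_n)[d d0 fD].
have fa : differentiable f a by apply: fD; rewrite subrr rnorm0.
have /continuous_rnormP/(_ 1 ltr01)[dl dl0 fdl] := differentiable_continuous fa.
exists (Num.min d dl), (rnorm (f a) + 1); split; first by rewrite lt_min d0.
move=> w; rewrite lt_min => /andP[/fD fw /fdl ?]; split=> //.
by have := ler_rnormD (f w - f a) (f a); rewrite subrK; lra.
Qed.

(** The Taylor constant [A] does not depend on [k]. Hence the differentials at [a] converge, and the
    Taylor bound passes to the limit. *)
Lemma differentiable_lim (F : nat -> 'rV[C]_n -> C) f a (rho M : R) : 0 < rho ->
  (forall k w, rnorm (w - a) < rho -> differentiable (F k) w /\ rnorm (F k w) <= M) ->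
  (forall w, rnorm (w - a) < rho -> forall e : R, 0 < e ->
     exists K, forall k, (K <= k)%N -> rnorm (F k w - f w) <= e) ->
  differentiable f a.
Proof.
move=> rho0 FD Ff; pose r := rho / 4; have r0 : 0 < r by rewrite divr_gt0.
have r4 : 4 * r = rho by rewrite /r; field.
pose A : R := 8 * M / r ^+ 2.
have M0 : 0 <= M.
  have [|_] := FD 0%N a; first by rewrite subrr rnorm0.
  exact/le_trans/rnorm_ge0.
have A0 : 0 <= A by rewrite divr_ge0 ?sqr_ge0 // mulr_ge0.
have FT k h : rnorm h < r ->
    rnorm (F k (a + h) - F k a - 'd (F k) a h) <= A * rnorm h ^+ 2.
  by apply: ler_diff_taylor => // w; rewrite r4 => /(FD k)[].
have ball_line h : rnorm h < r -> rnorm (a + h - a) < rho.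
  by rewrite addrAC subrr add0r; lra.
have /choice[c cP] : forall j, exists l : C, forall e : R, 0 < e ->
    exists K, forall k, (K <= k)%N -> rnorm ('d (F k) a 'e_j - l) <= e.
  move=> j; apply: ccauchy_cvg => e e0; set v : 'rV[C]_n := 'e_j.
  have v0 := rnorm_ge0 v; have v20 : 0 <= A * rnorm v ^+ 2 by rewrite mulr_ge0 ?sqr_ge0.
  (* With this step [t], the Taylor error of every [F k] is at most [e / 4 * t], which leaves
     [e / 4 * t] for replacing [F k] by [f] at two points. *)
  have [t t0 [tr te]] : exists2 t : R, 0 < t &
      t * rnorm v < r /\ A * rnorm v ^+ 2 * t <= e / 4.
    have p1 : 0 < 2 * (rnorm v + 1) by lra.
    have p2 : 0 < 4 * (A * rnorm v ^+ 2 + 1) by lra.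
    set t1 := r / (2 * (rnorm v + 1)); set t2 := e / (4 * (A * rnorm v ^+ 2 + 1)).
    have t0 : 0 < Num.min t1 t2 by rewrite lt_min !divr_gt0.
    exists (Num.min t1 t2) => //.
    have : Num.min t1 t2 <= t1 by rewrite ge_min lexx.
    have : Num.min t1 t2 <= t2 by rewrite ge_min lexx orbT.
    by move: t0; set t := Num.min t1 t2 => t0; rewrite !ler_pdivlMr //; lra.
  have tn : rnorm (t%:C *: v) = t * rnorm v.
    by rewrite rnormZ rnorm_real gtr0_norm.
  have tv : rnorm (a + t%:C *: v - a) < rho by apply: ball_line; rewrite tn.
  have aa : rnorm (a - a) < rho by rewrite subrr rnorm0.
  have te0 : 0 < t * e / 8 by rewrite divr_gt0 // mulr_gt0.
  have [K KP] := Ff _ tv _ te0; have [L LP] := Ff _ aa _ te0.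
  exists (maxn K L).
  (* A difference quotient of the limit [f] serves as common reference for all large [k]. *)
  suff dP k : (maxn K L <= k)%N ->
      rnorm ('d (F k) a v - t%:C^-1 * (f (a + t%:C *: v) - f a)) <= e / 2.
    by move=> k l /dP kP /dP lP; exact: ler_rnorm_split kP lP.
  rewrite geq_max => /andP[/KP {}KP /LP {}LP].
  have tC0 : (t%:C : C) != 0 by rewrite (inj_eq (@complexI R) t 0) gt_eqF.
  have := FT k (t%:C *: v); rewrite tn => /(_ tr); rewrite linearZ /= => T.
  rewrite (_ : _ - _ = t%:C^-1 * ((F k (a + t%:C *: v) - f (a + t%:C *: v)) -
     (F k a - f a) - (F k (a + t%:C *: v) - F k a - t%:C *: 'd (F k) a v))); last first.
    by rewrite /GRing.scale /=; field.
  rewrite rnormM rnormV rnorm_real (gtr0_norm t0) ler_pdivrMl //.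
  apply: (le_trans (ler_rnormD _ _)); rewrite rnormN.
  have := ler_rnormD (F k (a + t%:C *: v) - f (a + t%:C *: v)) (- (F k a - f a)).
  rewrite rnormN.
  have : A * (t * rnorm v) ^+ 2 <= e / 4 * t.
    rewrite (_ : A * _ = A * rnorm v ^+ 2 * t * t); last by ring.
    by rewrite ler_pM2r.
  by lra.
apply: (@differentiable_lincomb _ _ _ _ c) => e e0.
have A1 : 0 < A + 1 by rewrite ltr_wpDl.
have eA : 0 < e / (A + 1) by rewrite divr_gt0.
exists (Num.min r (e / (A + 1))); first by rewrite lt_min r0.
move=> h; rewrite lt_min => /andP[hr]; rewrite ltr_pdivlMr // => he; have h0 := rnorm_ge0 h.
apply: (@le_trans _ _ (A * rnorm h ^+ 2)); last first.
  rewrite expr2 mulrA ler_wpM2r // ltW // (le_lt_trans _ he) // mulrC.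
  by rewrite ler_wpM2l // lerDl.
apply/ler_addgt0Pr => d d0.
have d30 : 0 < d / 3 by rewrite divr_gt0.
have [K KP] := Ff _ (ball_line _ hr) _ d30.
have [L LP] := Ff a ltac:(by rewrite subrr rnorm0) _ d30.
(* The [n] coefficient errors together contribute at most [d / 3]. *)
pose d' : R := d / (3 * (n%:R * rnorm h + 1)).
have nh0 : 0 <= n%:R * rnorm h by rewrite mulr_ge0.
have d'0 : 0 < d' by rewrite divr_gt0 // mulr_gt0 //; lra.
have /choice[N NP] : forall j, exists N, forall k, (N <= k)%N ->
    rnorm ('d (F k) a 'e_j - c j) <= d'.
  by move=> j; exact: cP.
pose k := maxn (maxn K L) (\max_j N j).
have {}KP : rnorm (F k (a + h) - f (a + h)) <= d / 3.
  by apply: KP; rewrite /k -maxnA leq_maxl.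
have {}LP : rnorm (F k a - f a) <= d / 3.
  by apply: LP; rewrite /k leq_max leq_max leqnn orbT.
have {}NP : rnorm ('d (F k) a h - lincomb c h) <= d / 3.
  have -> : 'd (F k) a h - lincomb c h = lincomb (fun j => 'd (F k) a 'e_j - c j) h.
    rewrite diff_lincomb /lincomb -sumrB; apply: eq_bigr => j _; ring.
  apply: (le_trans (ler_lincomb _ _)).
  apply: (@le_trans _ _ (n%:R * d' * rnorm h)).
    rewrite ler_wpM2r //; apply: (@le_trans _ _ (\sum_(j < n) d')).
      apply: ler_sum => j _; apply: NP; rewrite /k leq_max; apply/orP; right.
      exact: leq_bigmax.
    by rewrite sumr_const card_ord mulr_natl.
  rewrite mulrAC (_ : d / 3 = (n%:R * rnorm h + 1) * d'); last first.
    by rewrite /d'; field; rewrite gt_eqF //; lra.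
  by rewrite ler_pM2r //; lra.
rewrite (_ : f (a + h) - f a - _ = (F k (a + h) - F k a - 'd (F k) a h) +
   (('d (F k) a h - lincomb c h) + ((F k a - f a) - (F k (a + h) - f (a + h)))));
  last by ring.
apply: (le_trans (ler_rnormD _ _)); apply: lerD; first exact: FT.
apply: (le_trans (ler_rnormD _ _)).
have := ler_rnormD (F k a - f a) (- (F k (a + h) - f (a + h))).
by rewrite rnormN; lra.
Qed.
End SeveralVariables.

(** * Differentiability of partial derivatives and of quotients by a coordinate *)

Section Division.
Context {R : realType} {n : nat}.
Local Notation C := (Cplx R).
Implicit Types (f g : 'rV[C]_n -> C) (a v w : 'rV[C]_n).

Lemma near_near_rnorm (P : 'rV[C]_n -> Prop) a (r : R) :
  (forall w, rnorm (w - a) < r -> P w) ->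
  forall w, rnorm (w - a) < r -> \forall y \near w, P y.
Proof.
move=> aP w wa; apply/(@nbhs_rnormP _ 'rV[C]_n).
exists (r - rnorm (w - a)); first by rewrite subr_gt0.
move=> y yw; apply: aP; rewrite -(subrKA w).
by apply: (le_lt_trans (ler_rnormD _ _)); lra.
Qed.

Lemma exists_divn_lt (x d : R) : 0 < d -> exists K : nat, x / K.+1%:R < d.
Proof.
move=> d0; exists (Num.bound `|x / d|).
rewrite ltr_pdivrMr ?ltr0n // mulrC -ltr_pdivrMr //.
apply: (le_lt_trans (ler_norm _)); apply: (lt_trans (archi_boundP _)) => //.
by rewrite ltr_nat.
Qed.

Lemma differentiable_derive f v a : (\forall w \near a, differentiable f w) ->
  differentiable ('D_v f) a.
Proof.
move=> /near_bounded[r [M [r0 fP]]].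
pose rho := r / 16; have rho0 : 0 < rho by rewrite divr_gt0.
have rE : r = 16 * rho by rewrite /rho; field.
have v0 := rnorm_ge0 v.
(* Steps tending to [0] with [t k * rnorm v <= rho]; the added [1] covers [v = 0]. *)
pose t (k : nat) : R := rho / ((rnorm v + 1) * k.+1%:R).
have k0 (k : nat) : 0 < k.+1%:R :> R by rewrite ltr0n.
have t0 k : 0 < t k by rewrite divr_gt0 // mulr_gt0 // -?natr1; lra.
have tC0 k : ((t k)%:C : C) != 0 by rewrite (inj_eq (@complexI R) _ 0) gt_eqF.
have tv k : t k * rnorm v <= rho.
  rewrite /t mulrAC ler_pdivrMr; last by rewrite mulr_gt0 //; lra.
  rewrite ler_pM2l // (@le_trans _ _ (rnorm v + 1)) //; first by lra.
  by rewrite ler_peMr ?ler1n //; lra.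
apply: (@differentiable_lim _ _
  (fun k w => (t k)%:C^-1 * (f (w + (t k)%:C *: v) - f w)) _ _ (4 * rho)
  (2 * M / rho * rnorm v)); first by rewrite mulr_gt0.
- move=> k w wa; split.
    apply: differentiableM; first exact: differentiable_cst.
    apply: differentiableB; last by have [|] := fP w; [rewrite rE; lra|].
    apply: (@differentiable_comp _ _ _ _ (fun w => w + (t k)%:C *: v) f).
      exact: differentiableD.
    have [|//] := fP (w + (t k)%:C *: v).
    have := ler_rnormD (w - a) ((t k)%:C *: v).
    by rewrite addrAC rnormZ rnorm_real gtr0_norm // rE; have := tv k; lra.
  rewrite rnormM rnormV rnorm_real gtr0_norm // ler_pdivrMl // mulrCA.
  rewrite -[t k in leRHS](gtr0_norm (t0 k)) -rnorm_real -rnormZ.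
  apply: ler_diff_increment => //; last by rewrite rnormZ rnorm_real gtr0_norm.
    move=> y yw; have [|//] := fP y.
    by have := ler_rnormD (y - w) (w - a); rewrite subrKA rE; lra.
  move=> y yw; have [|//] := fP y.
  by have := ler_rnormD (y - w) (w - a); rewrite subrKA rE; lra.
move=> w wa e e0.
have [|fw _] := fP w; first by rewrite rE; lra.
have [d d0 dP] := cderiv_line v fw e0.
have [K Kd] := exists_divn_lt rho d0.
exists K => k Kk; have := dP (t k)%:C.
rewrite rnorm_real gtr0_norm // => /(_ _); rewrite add0r scale0r addr0 => kP.
rewrite (deriveE v fw).
rewrite (_ : _ - _ = (t k)%:C^-1 *
   (f (w + (t k)%:C *: v) - f w - 'd f w v * (t k)%:C)); last first.
  by move: (tC0 k); set z : C := (t k)%:C => z0; field.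
rewrite rnormM rnormV rnorm_real gtr0_norm // ler_pdivrMl // [leRHS]mulrC.
apply: kP; apply: le_lt_trans Kd; rewrite /t ler_pM2l //.
rewrite lef_pV2 ?posrE //; last by rewrite mulr_gt0 //; lra.
apply: (@le_trans _ _ k.+1%:R); first by rewrite ler_nat.
by rewrite ler_peMl // lerDr.
Qed.

Lemma scale_coordE (i : 'I_n) (z : C) w :
  scale_coord i z w = w + ((z - 1) * w 0 i) *: 'e_i.
Proof.
apply/rowP => j; rewrite !mxE eqxx /=; case: eqVneq => [->|_] /=; ring.
Qed.

Lemma differentiable_scale_coord (i : 'I_n) (z : C) w :
  differentiable (scale_coord i z) w.
Proof.
rewrite (_ : scale_coord i z = fun w => w + ((z - 1) * w 0 i) *: 'e_i); last first.
  by apply/funext => y; exact: scale_coordE.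
apply: differentiableD => //; apply: differentiableZl.
apply: differentiableM; [exact: differentiable_cst|exact: differentiable_coord].
Qed.

(** Keeps the nodes of the Riemann sums below inside the ball on which bounds are known. *)
Lemma rnorm_scale_coord (i : 'I_n) (z : C) w a (r : R) : 0 < r -> a 0 i = 0 ->
  rnorm z <= 1 -> rnorm (w - a) < r -> rnorm (scale_coord i z w - a) < r.
Proof.
move=> r0 ai z1 /rnorm_lt_coord - /(_ r0) wa; apply/rnorm_lt_coord => // j.
have := wa j; rewrite !mxE; case: eqVneq => // ->; rewrite ai !subr0.
by rewrite rnormM; apply: le_lt_trans; rewrite ler_piMl ?rnorm_ge0.
Qed.

(** On the hyperplane the value is the limit of the quotient when [f] vanishes there. *)
Definition coord_quotient (i : 'I_n) f : 'rV[C]_n -> C :=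
  fun w => if w 0 i == 0 then partial i f w else f w / w 0 i.

Lemma differentiable_coord_quotient (i : 'I_n) f a :
  (\forall w \near a, differentiable f w) ->
  (\forall w \near a, (w : 'rV[C]_n) 0 i = 0 -> f w = 0) ->
  differentiable (coord_quotient i f) a.
Proof.
have [ai|ai] := eqVneq (a 0 i) 0; last first.
  move=> fD _; have an : 0 < rnorm (a 0 i) by rewrite rnorm_gt0.
  apply: (@near_eq_differentiable R n (fun w => f w * (w 0 i)^-1)).
    apply/(@nbhs_rnormP _ 'rV[C]_n); exists (rnorm (a 0 i)) => // w wa.
    rewrite /coord_quotient ifF //; apply/negbTE; apply: contraTneq wa => w0.
    rewrite -leNgt -rnormN; apply: le_trans (ler_coord_rnorm _ i).
    by rewrite !mxE w0 sub0r.
  apply: differentiableM; first exact: nbhs_singleton fD.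
  by apply: differentiableV => //; exact: differentiable_coord.
move=> fnear f0near.
have [r [M [r0 fP]]] := near_bounded fnear.
move/(@nbhs_rnormP _ 'rV[C]_n) : f0near => [s s0 f0].
have : \forall w \near a, differentiable (partial i f) w.
  apply/(@nbhs_rnormP _ 'rV[C]_n); exists r => // w wr.
  apply: differentiable_derive.
  by apply: (@near_near_rnorm (fun y => differentiable f y) a r) => // y /fP[].
move=> /near_bounded[r' [M' [r'0 pP]]].
pose rho := Num.min (Num.min r s) r' / 16.
have [rho0 [rhor [rhos rhor']]] : 0 < rho /\ 16 * rho <= r /\ 16 * rho <= s /\ 16 * rho <= r'.
  rewrite /rho (mulrC 16) divfK // divr_gt0 ?lt_min ?r0 ?s0 //; split=> //.
  by rewrite !ge_min !lexx !orbT.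
have k0 (k : nat) : 0 < k.+1%:R :> R by rewrite ltr0n.
have kC0 (k : nat) : (k.+1%:R : C) != 0 by rewrite pnatr_eq0.
have M0 : 0 <= M.
  have [|_] := fP a; first by rewrite subrr rnorm0.
  exact/le_trans/rnorm_ge0.
pose z (k j : nat) : C := j%:R / k.+1%:R.
have zn k j : (j <= k.+1)%N -> rnorm (z k j) <= 1.
  by move=> jk; rewrite /z rnormM rnormV !rnorm_nat ler_pdivrMr // mul1r ler_nat.
(* Riemann sums of the integral of [partial i f] along the segment from [w] with
   its [i]-th coordinate set to [0] up to [w]. *)
pose F k w := k.+1%:R^-1 * \sum_(j < k.+1) partial i f (scale_coord i (z k j) w).
have sP k (j : 'I_k.+1) w : rnorm (w - a) < rho ->
    rnorm (scale_coord i (z k j) w - a) < rho.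
  by apply: rnorm_scale_coord => //; apply: zn; exact: ltnW.
apply: (@differentiable_lim _ _ F _ _ rho M') => //.
- move=> k w wa; split.
    apply: differentiableM; first exact: differentiable_cst.
    rewrite (_ : (fun w => _) = \sum_(j < k.+1) (partial i f \o scale_coord i (z k j))); last first.
      by apply/funext => y; rewrite fct_sumE.
    apply: differentiable_sum => j; apply: differentiable_comp.
      exact: differentiable_scale_coord.
    have [|//] := pP (scale_coord i (z k j) w).
    by have := sP k j w wa; lra.
  rewrite rnormM rnormV rnorm_nat ler_pdivrMl //.
  apply: (le_trans (ler_rnorm_sum _)).
  apply: (@le_trans _ _ (\sum_(j < k.+1) M')).
    apply: ler_sum => j _; have [|//] := pP (scale_coord i (z k j) w).
    by have := sP k j w wa; lra.
  by rewrite sumr_const card_ord mulr_natl.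
move=> w wa e e0; rewrite /coord_quotient; have [w0|w0] := eqVneq (w 0 i) 0.
  exists 0%N => k _; rewrite /F (_ : \sum_(_ < _) _ = k.+1%:R * partial i f w).
    by rewrite mulKf // subrr rnorm0 ltW.
  under eq_bigr do rewrite scale_coordE w0 mulr0 scale0r addr0.
  by rewrite sumr_const card_ord mulr_natl.
set t := w 0 i; set E : R := rnorm ('e_i : 'rV[C]_n).
have E0 : 0 <= E := rnorm_ge0 _.
have t0 : 0 < rnorm t by rewrite rnorm_gt0.
(* The total error is [B / k.+1%:R]: there are [k.+1] Taylor errors of order [k.+1%:R ^- 2], divided
   by [t]. *)
pose B := 8 * M / rho ^+ 2 * (rnorm t * E ^+ 2).
have B0 : 0 <= B.
  by rewrite /B !mulr_ge0 ?invr_ge0 ?sqr_ge0 // ltW.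
have [K1 K1P] := exists_divn_lt (rnorm t * E) rho0.
have [K2 K2P] := exists_divn_lt B e0.
exists (maxn K1 K2) => k; rewrite geq_max => /andP[kK1 kK2].
have div_le (x : R) K : 0 <= x -> (K <= k)%N -> x / k.+1%:R <= x / K.+1%:R.
  by move=> x0 Kk; rewrite ler_wpM2l // lef_pV2 ?posrE // ler_nat.
have tE0 : 0 <= rnorm t * E by rewrite mulr_ge0 // ltW.
have {K1P}tE : rnorm t * E / k.+1%:R < rho := le_lt_trans (div_le _ _ tE0 kK1) K1P.
have {K2P}Be : B / k.+1%:R <= e := ltW (le_lt_trans (div_le _ _ B0 kK2) K2P).
apply: le_trans Be.
pose p j := scale_coord i (z k j) w.
have pS j : p j.+1 = p j + (t / k.+1%:R) *: 'e_i.
  rewrite /p !scale_coordE -addrA -scalerDl; congr (_ + _ *: _).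
  by rewrite /z -natr1 -/t; field.
have p0 : f (p 0%N) = 0.
  apply: f0; last by rewrite /p /z mul0r mxE eqxx mul0r.
  by apply: lt_le_trans (sP k ord0 w wa) _; lra.
have pN : p k.+1 = w.
  by rewrite /p /z divff // scale_coordE subrr mul0r scale0r addr0.
(* The increments of [f] along the nodes telescope to [f w], since [f] vanishes at the first
   node. *)
have -> : F k w - f w / t = - (t^-1 * \sum_(j < k.+1)
    (f (p j.+1) - f (p j) - t / k.+1%:R * partial i f (p j))).
  rewrite sumrB -(big_mkord xpredT (fun j => f (p j.+1) - f (p j))).
  rewrite telescope_sumr // pN p0 subr0 -mulr_sumr mulrBr opprB.
  by rewrite mulrA mulrA mulVf // mul1r [f w / t]mulrC.
rewrite rnormN rnormM rnormV ler_pdivrMl //.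
apply: (le_trans (ler_rnorm_sum _)).
pose A : R := 8 * M / rho ^+ 2.
apply: (@le_trans _ _ (\sum_(j < k.+1) A * (rnorm t * E / k.+1%:R) ^+ 2)); last first.
  rewrite sumr_const card_ord -mulr_natl le_eqVlt; apply/orP; left; apply/eqP.
  by rewrite /B -/A; field; rewrite lt0r_neq0.
apply: ler_sum => j _; have pj := sP k j w wa.
have nh : rnorm ((t / k.+1%:R) *: ('e_i : 'rV[C]_n)) = rnorm t * E / k.+1%:R.
  by rewrite rnormZ rnormM rnormV rnorm_nat mulrAC.
have [|fp _] := fP (p j); first by rewrite /p; lra.
rewrite /partial (deriveE _ fp) pS -[_ * 'd f _ _]/(_ *: 'd f (p j) 'e_i) -linearZ -nh.
have pD y : rnorm (y - p j) < 4 * rho -> differentiable f y /\ rnorm (f y) <= M.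
  move=> yp; apply: fP; rewrite -(subrKA (p j)).
  by apply: (le_lt_trans (ler_rnormD _ _)); move: pj yp; rewrite -/(p j); lra.
apply: (@ler_diff_taylor R 'rV[C]_n f (p j) rho M rho0).
- by move=> y /pD[].
- by move=> y /pD[].
by rewrite nh.
Qed.
End Division.

(** * Functions invariant under roots of unity *)

Section Invariance.
Context {R : realType} {n : nat}.
Local Notation C := (Cplx R).
Implicit Types (f g : 'rV[C]_n -> C) (a v w x : 'rV[C]_n).

Lemma cderiv_unique (f g : C -> C) (z d d' : C) (r : R) : 0 < r ->
  (forall h, rnorm h < r -> f (z + h) = g (z + h)) ->
  cderiv f z d -> cderiv g z d' -> d = d'.
Proof.
move=> r0 fg fd gd; apply/eqP; rewrite -subr_eq0 -rnorm_eq0.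
rewrite eq_le rnorm_ge0 andbT; apply/ler_addgt0Pr => e e0.
rewrite add0r; have [u u0 uP] := fd _ (divr_gt0 e0 (ltr0n R 2)).
have [v v0 vP] := gd _ (divr_gt0 e0 (ltr0n R 2)).
pose m := Num.min r (Num.min u v); have m0 : 0 < m by rewrite !lt_min r0 u0.
pose h : C := (m / 2)%:C.
have hm : rnorm h < m by rewrite rnorm_real gtr0_norm ?divr_gt0 //; lra.
have h0 : 0 < rnorm h by rewrite rnorm_real normr_gt0 gt_eqF // divr_gt0.
move: (hm); rewrite !lt_min => /and3P[hr hu hv].
rewrite -(ler_pM2r h0) -rnormM.
rewrite (_ : _ * h = (g (z + h) - g z - d' * h) - (f (z + h) - f z - d * h)); last first.
  have := fg 0; rewrite rnorm0 addr0 => /(_ r0) ->; rewrite fg //; ring.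
apply: (le_trans (ler_rnormD _ _)); rewrite rnormN.
by have := uP h hu; have := vP h hv; lra.
Qed.

Lemma derive_near_eq f g v a : (\forall w \near a, f w = g w) ->
  differentiable f a -> 'D_v f a = 'D_v g a.
Proof.
move=> fg fa; have ga := near_eq_differentiable fg fa.
rewrite (deriveE v fa) (deriveE v ga).
move/(@nbhs_rnormP _ 'rV[C]_n) : fg => [r r0 fg].
have r1 : 0 < r / (rnorm v + 1) by rewrite divr_gt0 // ltr_wpDl ?rnorm_ge0.
apply: (cderiv_unique r1 _ (cderiv_line v fa) (cderiv_line v ga)) => h.
rewrite add0r ltr_pdivlMr ?ltr_wpDl ?rnorm_ge0 // => hr; apply: fg.
rewrite addrAC subrr add0r rnormZ; apply: le_lt_trans hr.
by rewrite ler_wpM2l ?rnorm_ge0 // lerDl.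
Qed.

Lemma derive_coord (i : 'I_n) a : 'D_'e_i (fun w => w 0 i : C) a = 1.
Proof.
have ca : differentiable (fun w => w 0 i : C) a by exact: differentiable_coord.
rewrite (deriveE _ ca).
apply: (cderiv_unique ltr01 _ (cderiv_line _ ca) (cderiv_affine (a 0 i) 1 0)) => h _.
by rewrite !mxE !eqxx mulr1 mul1r.
Qed.

(** Continuity at [a], tested at a nearby point moved off the hyperplane along ['e_i]. *)
Lemma eq_off_hyperplane f g (i : 'I_n) a : a 0 i = 0 ->
  (\forall w \near a, (w : 'rV[C]_n) 0 i != 0 -> f w = g w) ->
  differentiable f a -> differentiable g a -> f a = g a.
Proof.
move=> ai /(@nbhs_rnormP _ 'rV[C]_n)[r r0 fg] fa ga.
apply/eqP; rewrite -subr_eq0 -rnorm_eq0 eq_le rnorm_ge0 andbT.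
apply/ler_addgt0Pr => e e0; rewrite add0r.
have e20 : 0 < e / 2 by rewrite divr_gt0.
have /continuous_rnormP/(_ _ e20)[u u0 uP] := differentiable_continuous fa.
have /continuous_rnormP/(_ _ e20)[v v0 vP] := differentiable_continuous ga.
pose m := Num.min r (Num.min u v); have m0 : 0 < m by rewrite !lt_min r0 u0.
pose t : R := m / (rnorm ('e_i : 'rV[C]_n) + 1).
have t0 : 0 < t by rewrite divr_gt0 // ltr_wpDl ?rnorm_ge0.
pose w := a + t%:C *: 'e_i.
have : rnorm (w - a) < m.
  rewrite /w addrAC subrr add0r rnormZ rnorm_real gtr0_norm // /t.
  by rewrite mulrAC ltr_pdivrMr ?ltr_wpDl ?rnorm_ge0 // ltr_pM2l // ltrDl.
rewrite !lt_min => /and3P[wr wu wv].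
have wi : w 0 i != 0.
  by rewrite !mxE ai add0r !eqxx mulr1 (inj_eq (@complexI R) t 0) gt_eqF.
rewrite (_ : f a - g a = (g w - g a) - (f w - f a)); last by rewrite (fg w wr wi); ring.
apply: (le_trans (ler_rnormD _ _)); rewrite rnormN.
by have := uP w wu; have := vP w wv; lra.
Qed.

Lemma polydisc_rnorm x0 (rho : 'I_n -> R) x :
  polydisc x0 rho x <-> forall j, rnorm (x 0 j - x0 0 j) < rho j.
Proof. by split=> xU j; have := xU j; rewrite rnormE ltcR. Qed.

Lemma near_polydisc x0 (rho : 'I_n -> R) x :
  polydisc x0 rho x -> \forall w \near x, polydisc x0 rho w.
Proof.
move=> /polydisc_rnorm xU.
suff : \forall w \near x, forall j, rnorm ((w : 'rV[C]_n) 0 j - x0 0 j) < rho j.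
  by apply: filterS => w ?; apply/polydisc_rnorm.
apply: (@filter_forall 'rV[C]_n 'I_n
  (fun j w => rnorm (w 0 j - x0 0 j) < rho j) (nbhs x) (nbhs_filter x)) => j.
apply/(@nbhs_rnormP _ 'rV[C]_n).
exists (rho j - rnorm (x 0 j - x0 0 j)); first by rewrite subr_gt0.
move=> y yx; rewrite -(subrKA (x 0 j)).
apply: (le_lt_trans (ler_rnormD _ _)).
by have := ler_coord_rnorm (y - x) j; rewrite !mxE; lra.
Qed.

(** * Factoring powers of a coordinate on a polydisc *)

Section Polydisc.
Variables (x0 : 'rV[C]_n) (rho : 'I_n -> R).
Local Notation U := (polydisc x0 rho).

Lemma near_holomorphic f a : holomorphic_on U f -> U a ->
  \forall w \near a, differentiable f w.
Proof. by move=> fU /near_polydisc; apply: filterS => w /fU. Qed.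

Lemma holomorphic_partial (i : 'I_n) f :
  holomorphic_on U f -> holomorphic_on U (partial i f).
Proof. by move=> fU a aU; apply: differentiable_derive; exact: near_holomorphic. Qed.

Lemma holomorphic_coord_quotient (i : 'I_n) f : holomorphic_on U f ->
  (forall x, U x -> x 0 i = 0 -> f x = 0) -> holomorphic_on U (coord_quotient i f).
Proof.
move=> fU f0 a aU; apply: differentiable_coord_quotient.
  exact: near_holomorphic.
by move/near_polydisc : aU; apply: filterS => w /f0.
Qed.

(** One derivative turns [x_i^(m+1) g] into [x_i^m h] with [h = (m+1) g + x_i (partial i g)], again
    holomorphic, and [h x0 = (m+1) g x0]. *)
Lemma iter_partial_monomial (i : 'I_n) m f g : U x0 -> x0 0 i = 0 ->
  holomorphic_on U g -> (forall x, U x -> f x = x 0 i ^+ m * g x) ->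
  (forall j, (j < m)%N -> iter j (partial i) f x0 = 0) /\
  iter m (partial i) f x0 = m`!%:R * g x0.
Proof.
move=> Ux0 x0i; elim: m f g => [|m IH] f g gU fE.
  by split=> //; rewrite /= fE // expr0.
pose h x : C := m.+1%:R * g x + x 0 i * partial i g x.
have hU : holomorphic_on U h.
  move=> x xU; apply: differentiableD; apply: differentiableM.
  - exact: differentiable_cst.
  - exact: gU.
  - exact: differentiable_coord.
  exact: holomorphic_partial.
have f'E x : U x -> partial i f x = x 0 i ^+ m * h x.
  move=> xU; pose c w : C := w 0 i.
  have cx : differentiable c x by exact: differentiable_coord.
  have gx := gU x xU.
  rewrite /partial -(@derive_near_eq (c ^+ m.+1 * g)); last first.
  - by apply: differentiableM => //; exact: differentiableX.
  - by move/near_polydisc : xU; apply: filterS => w /fE ->; rewrite fctE exprfctE.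
  rewrite deriveM; [|exact/diff_derivable/differentiableX|exact/diff_derivable].
  rewrite deriveX; last exact/diff_derivable.
  rewrite derive_coord /h /partial exprfctE /GRing.scale /= exprS /c; ring.
have [IH0 IHm] := IH _ _ hU f'E; split.
  move=> [_|j jm]; first by rewrite /= fE // x0i exprS !mul0r.
  by rewrite iterSr; exact: IH0.
by rewrite iterSr IHm /h x0i mul0r addr0 factS natrM; ring.
Qed.

Lemma polydisc_scale_coord (i : 'I_n) (z : C) x : x0 0 i = 0 -> rnorm z = 1 ->
  U x -> U (scale_coord i z x).
Proof.
move=> x0i z1 /polydisc_rnorm xU; apply/polydisc_rnorm => j; have := xU j.
by rewrite !mxE; case: eqVneq => // ->; rewrite x0i !subr0 rnormM z1 mul1r.
Qed.

(** Along the line through [x] in direction ['e_i], invariance turns a step [h] at [x] into the step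
    [z * h] at the scaled point. *)
Lemma partial_invariant (i : 'I_n) (z : C) f x : x0 0 i = 0 -> rnorm z = 1 ->
  holomorphic_on U f -> (forall y, U y -> f (scale_coord i z y) = f y) ->
  U x -> z * partial i f (scale_coord i z x) = partial i f x.
Proof.
move=> x0i z1 fU fz xU; have zxU := polydisc_scale_coord x0i z1 xU.
rewrite /partial (deriveE _ (fU x xU)) (deriveE _ (fU _ zxU)).
rewrite -[z * _]/(z *: 'd f (scale_coord i z x) 'e_i) -linearZ.
have /near_polydisc/(@nbhs_rnormP _ 'rV[C]_n)[r r0 rU] := xU.
pose E : R := rnorm ('e_i : 'rV[C]_n) + 1.
have E0 : 0 < E by rewrite /E ltr_wpDl ?rnorm_ge0.
apply: (cderiv_unique (divr_gt0 r0 E0) _ (cderiv_line _ (fU _ zxU))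
  (cderiv_line _ (fU x xU))) => h.
rewrite add0r ltr_pdivlMr // => hr.
rewrite -[RHS]fz; last first.
  apply: rU; rewrite addrAC subrr add0r rnormZ; apply: le_lt_trans hr.
  by rewrite ler_wpM2l ?rnorm_ge0 // lerDl.
congr f; apply/rowP => j; rewrite !mxE eqxx /=; case: eqVneq => _ /=; ring.
Qed.

Lemma partial_factor (i : 'I_n) r f : x0 0 i = 0 -> holomorphic_on U f ->
  (forall m, (0 < m < r)%N -> exists z : C, [/\ rnorm z = 1, z ^+ m != 1 &
     forall y, U y -> f (scale_coord i z y) = f y]) ->
  forall j, (j < r)%N -> exists2 g, holomorphic_on U g &
    forall x, U x -> partial i f x = x 0 i ^+ j * g x.
Proof.
move=> x0i fU fz; elim=> [|j IH] jr.
  exists (partial i f); first exact: holomorphic_partial.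
  by move=> x _; rewrite expr0 mul1r.
have [g gU gE] := IH (ltnW jr).
have [z [z1 zj fzE]] := fz j.+1 jr.
have g0 a : U a -> a 0 i = 0 -> g a = 0.
  (* The exponent is [j] from the extracted power plus one from differentiation. Off the hyperplane
     [x_i^j] cancels; continuity reaches [a], which scaling fixes. *)
  move=> aU ai; have E : z ^+ j.+1 * g a = g a.
    have sa : scale_coord i z a = a by rewrite scale_coordE ai mulr0 scale0r addr0.
    rewrite -{1}sa.
    apply: (@eq_off_hyperplane (fun x => z ^+ j.+1 * g (scale_coord i z x)) g i a ai).
    - move/near_polydisc : aU; apply: filterS => w wU wi.
      have wj : w 0 i ^+ j != 0 by rewrite expf_neq0.
      have := partial_invariant x0i z1 fU fzE wU.
      rewrite gE ?gE //; last exact: polydisc_scale_coord.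
      rewrite mxE eqxx exprMn => Ew; apply: (mulfI wj); rewrite -Ew exprS; ring.
    - apply: differentiableM; first exact: differentiable_cst.
      apply: (@differentiable_comp _ _ _ _ (scale_coord i z) g).
        exact: differentiable_scale_coord.
      by apply: gU; rewrite sa.
    exact: gU.
  move/eqP : E; rewrite -subr_eq0 -{2}[g a]mul1r -mulrBl mulf_eq0 subr_eq0.
  by rewrite (negbTE zj) => /eqP.
exists (coord_quotient i g); first exact: holomorphic_coord_quotient.
move=> x xU; rewrite gE // exprSr -mulrA /coord_quotient; congr (_ * _).
case: eqVneq => [xi|xi]; first by rewrite xi mul0r g0.
by rewrite mulrC divfK.
Qed.

End Polydisc.

(** The witness is [exp (2 pi i / r)]. If its [m]-th power were [1], then [cos (2 s) = 1] with
    [s = pi m / r], against [sin s > 0]. *)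
Lemma root_of_unity_exists r m : (0 < m < r)%N ->
  exists z : C, [/\ rnorm z = 1, z ^+ m != 1 & z ^+ r = 1].
Proof.
move=> /andP[m0 mr]; have r0 : (0 : R) < r%:R by rewrite ltr0n (ltn_trans m0).
pose t : R := pi *+ 2 / r%:R.
have cexpX k : cexp (0 +i* t : C) ^+ k = cexp (0 +i* (t *+ k)).
  elim: k => [|k IH]; first by rewrite expr0 mulr0n cexp0.
  rewrite exprS IH -cexpD mulrS; congr cexp.
  by apply/eqP; rewrite eq_complex /= addr0 !eqxx.
exists (cexp (0 +i* t)); split; first by rewrite rnorm_cexp expR0.
  rewrite cexpX; apply/eqP => /(congr1 (@complex.Re R)).
  rewrite /cexp /= expR0 mul0r subr0 mul1r => cos1.
  pose s : R := t *+ m / 2.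
  have s0 : 0 < sin s.
    have -> : s = pi * (m%:R / r%:R).
      by rewrite /s /t -mulr_natr -[pi *+ 2]mulr_natr; field; rewrite gt_eqF.
    apply: sin_gt0_pi.
    rewrite mulr_gt0 ?pi_gt0 ?divr_gt0 ?ltr0n ?m0 ?(ltn_trans m0 mr) //=.
    by rewrite gtr_pMr ?pi_gt0 // ltr_pdivrMr // mul1r ltr_nat.
  have := cosD s s; rewrite (_ : s + s = t *+ m); last by rewrite /s -splitr.
  have := cos2Dsin2 s; rewrite cos1 !expr2.
  by have := mulr_gt0 s0 s0; lra.
rewrite cexpX (_ : t *+ r = pi *+ 2); first exact: cexp_2pi.
by rewrite /t -[LHS]mulr_natr divfK // gt_eqF.
Qed.

End Invariance.

(** * Derivatives at the centre and extension across the hyperplane *)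

Theorem theorem8p5 (R : realType) (n r : nat)
  (hn : (1 <= n)%N) (hr : (1 <= r)%N)
  (i0 : 'I_n) (x0 : 'rV[Cplx R]_n) (hx0 : x0 0 i0 = 0)
  (rho : 'I_n -> R) (hrho : forall j, 0 < rho j)
  (phi : 'rV[Cplx R]_n -> Cplx R)
  (hphi : holomorphic_on (polydisc x0 rho) phi)
  (hinv : forall (zeta : Cplx R) (x : 'rV[Cplx R]_n),
    r.-unity_root zeta -> polydisc x0 rho x ->
    phi (scale_coord i0 zeta x) = phi x) :
  (forall m : nat, (1 <= m <= r - 1)%N -> iter m (partial i0) phi x0 = 0) /\
  (exists psi : 'rV[Cplx R]_n -> Cplx R,
     holomorphic_extension_across i0 (polydisc x0 rho) (Delta r i0 phi) psi) /\
  (forall psi : 'rV[Cplx R]_n -> Cplx R,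
     holomorphic_extension_across i0 (polydisc x0 rho) (Delta r i0 phi) psi ->
     psi x0 = (r`!)%:R^-1 * iter r (partial i0) phi x0).
Proof.
have Ux0 : polydisc x0 rho x0.
  by apply/polydisc_rnorm => j; rewrite subrr rnorm0.
have roots m : (0 < m < r)%N -> exists z : Cplx R, [/\ rnorm z = 1, z ^+ m != 1 &
    forall y, polydisc x0 rho y -> phi (scale_coord i0 z y) = phi y].
  move=> /(@root_of_unity_exists R)[z [z1 zm zr]]; exists z; split=> // y.
  by apply: hinv; rewrite unity_rootE zr.
have r1 : (r.-1 < r)%N by rewrite prednK.
have [g gU gE] := partial_factor hx0 hphi roots r1.
(* Applied to [partial i0 phi] with exponent [r.-1], so the order of differentiation of [phi] is one
   higher than the iteration index here. *)
have [iter0 iterr] := iter_partial_monomial Ux0 hx0 gU gE.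
have rn : (r%:R : Cplx R) != 0 by rewrite pnatr_eq0 -lt0n.
pose psi0 x := r%:R^-1 * g x.
have psi0U : holomorphic_on (polydisc x0 rho) psi0.
  by move=> x xU; apply: differentiableM; [exact: differentiable_cst|exact: gU].
have psi0E x : polydisc x0 rho x -> x 0 i0 != 0 -> psi0 x = Delta r i0 phi x.
  move=> xU xi; rewrite /Delta gE // invfM -mulrA mulKf //.
  by rewrite expf_neq0.
split; last split.
- move=> m /andP[m0 mr]; rewrite -(prednK m0) iterSr; apply: iter0.
  by rewrite prednK // -subn1.
- by exists psi0.
move=> psi [psiU psiE].
(* Any two extensions agree off the hyperplane, hence at [x0] by continuity. *)
have -> : psi x0 = psi0 x0.
  apply: (eq_off_hyperplane hx0); [|exact: psiU|exact: psi0U].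
  move/near_polydisc : Ux0; apply: filterS => w wU wi.
  by rewrite psiE // psi0E.
(* The [r]-th derivative is [(r-1)! g x0], and [(r-1)! / r!] is the factor [1 / r] of [psi0]. *)
rewrite -{2}(prednK hr) iterSr iterr /psi0 mulrA; congr (_ * _).
have fn : (r.-1`!%:R : Cplx R) != 0 by rewrite pnatr_eq0 -lt0n fact_gt0.
by rewrite -{2}(prednK hr) factS prednK // natrM invfM -mulrA mulVf ?mulr1.
Qed.
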